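(* Let $d\ge 1$, let the couplings $J=(J_b)_b$ be IID real random variables with a continuous distribution, and let $\varepsilon,\varepsilon'$ be the perturbations described in the context. Then for every box $\Lambda$ (and every choice of boundary condition) there is an event $A=A_\Lambda$, not depending on $\delta$ or $t$, whose probability is positive uniformly in $\Lambda$ (i.e. $\mathbb{P}(A_\Lambda)\ge c$ for some constant $c>0$ not depending on $\Lambda$), such that the following holds. For any $\delta>0$ there exists $t_0=t_0(\delta)>0$, not depending on $\Lambda$, such that $$\mathbb{E}\big[Q_\Lambda(\sigma(J+t\varepsilon),\sigma(J+t\varepsilon'))\big]>(1-\delta)\,\mathbb{P}(A)\qquad\text{for all } 0\le t<t_0(\delta).$$
   Context: A box $\Lambda\subset\mathbb{Z}^d$ is a translate of $\{1,\dots,n\}^d$ with $n\ge 2$. Its exterior vertex boundary $\partial\Lambda$ is the set of vertices of $\mathbb{Z}^d\setminus\Lambda$ with a nearest neighbor in $\Lambda$. For a finite vertex set $V$, $V^*$ denotes the set of nearest-neighbor edges of $\mathbb{Z}^d$ with both endpoints in $V$. A boundary condition is a fixed assignment of values $s_x\in\{-1,+1\}$ for $x\in\partial\Lambda$. For $J\in\mathbb{R}^{(\Lambda\cup\partial\Lambda)^*}$ and $s\in\{-1,+1\}^\Lambda$ (extended to $\partial\Lambda$ by the boundary condition), the Edwards-Anderson Hamiltonian is $$H_{\Lambda,J}(s)=\sum_{\{x,y\}\in(\Lambda\cup\partial\Lambda)^*}-J_{xy}s_xs_y .$$ The ground state $\sigma(J)$ is the minimizer of $H_{\Lambda,J}$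 over $\{-1,+1\}^\Lambda$. It is unique for $J$ outside the critical set $$\mathcal{C}=\bigcup_{s\ne s'\in\{-1,+1\}^\Lambda}\Big\{J:\sum_{\{x,y\}\in(\Lambda\cup\partial\Lambda)^*}J_{xy}(s_xs_y-s'_xs'_y)=0\Big\},$$ which has probability $0$ when the couplings are independent with continuous (atomless) distributions. The overlap is $Q_\Lambda(\sigma,\sigma')=\frac{1}{|\Lambda^*|}\sum_{\{x,y\}\in\Lambda^*}\sigma_x\sigma_y\sigma'_x\sigma'_y$. Under $\mathbb{P}$ (with expectation $\mathbb{E}$), the couplings $(J_b)_{b\in(\Lambda\cup\partial\Lambda)^*}$ are IID with a continuous law that does not depend on $\Lambda$ (no symmetry is assumed). The perturbations $\varepsilon=(\varepsilon_b)_b$ and $\varepsilon'=(\varepsilon'_b)_b$, indexed by $b\in(\Lambda\cup\partial\Lambda)^*$, are independent of each other and of $J$, and all their entries are IID with a fixed continuous distribution of mean $0$ (not depending on $\Lambda$). The sums $J+t\varepsilon$, $J+t\varepsilon'$ are taken edge by edge. *)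

(* Defs.v *)
From HB Require Import structures.
From mathcomp Require Import all_boot all_order all_algebra finmap.
From mathcomp Require Import all_classical all_reals all_analysis.

Set Implicit Arguments.
Unset Strict Implicit.
Unset Printing Implicit Defensive.

Import Order.TTheory GRing.Theory Num.Theory.

Local Open Scope ring_scope.

Notation vertex d := 'rV[int]_d.

Section Lattice.
Variable d : nat.

Definition unit_vec (i : 'I_d) : vertex d := delta_mx 0 i.

Definition neighbors (x : vertex d) : {fset vertex d} :=
  ([fset (x + unit_vec i)%R | i : 'I_d] `|` [fset (x - unit_vec i)%R | i : 'I_d])%fset.

Definition box_point (a : vertex d) (n : nat) (f : {ffun 'I_d -> 'I_n}) :
    vertex d :=
  a + \row_i (f i).+1%:Z.

(* The box a + {1, ..., n}^d: ['I_n] enumerates 0, ..., n - 1. *)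
Definition box (a : vertex d) (n : nat) : {fset vertex d} :=
  [fset box_point a f | f : {ffun 'I_d -> 'I_n}]%fset.

Definition boundary (L : {fset vertex d}) : {fset vertex d} :=
  ((\bigcup_(x <- L) neighbors x) `\` L)%fset.

(* An undirected edge is the two-element set of its endpoints. *)
Definition edges (V : {fset vertex d}) : {fset {fset vertex d}} :=
  [fset [fset x; y] | x in V, y in V & y \in neighbors x]%fset.

Definition closed_edges (L : {fset vertex d}) : {fset {fset vertex d}} :=
  edges (L `|` boundary L)%fset.

End Lattice.

Section EdwardsAnderson.
Variables (R : realType) (d : nat) (L : {fset vertex d}).

(* Spins are stored as booleans: [false] stands for +1 and [true] for -1. *)
Local Notation config := {ffun L -> bool}.

(* A boundary condition is given as a function on all vertices; only its values
   on [boundary L] enter the Hamiltonian. *)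
Definition spin (bc : vertex d -> bool) (s : config) (x : vertex d) : R :=
  (-1) ^+ (if insub x is Some u then s u else bc x).

Definition hamiltonian (bc : vertex d -> bool) (J : closed_edges L -> R)
    (s : config) : R :=
  \sum_(b : closed_edges L) - J b * \prod_(x <- val b) spin bc s x.

(* On the critical set, where the minimizer is not unique, this is some
   minimizer chosen by the (fixed) enumeration of [config]. *)
Definition ground_state (bc : vertex d -> bool) (J : closed_edges L -> R) :
    config :=
  [arg min_(s < ([ffun=> false] : config)) hamiltonian bc J s]%O.

(* Edges of [edges L] have both endpoints in [L], so the boundary condition
   plays no role here and is filled in with a dummy. *)
Definition overlap (s s' : config) : R :=
  let sp := spin (fun=> false) in
  (#|` edges L|%:R)^-1 *
  \sum_(b <- edges L) \prod_(x <- b) (sp s x * sp s' x).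

End EdwardsAnderson.

Section Probability.
Context {dT : measure_display} {T : measurableType dT} {R : realType}.
Variable P : probability T R.

Local Open Scope classical_set_scope.

(* For a finite family, the product rule over all sub-families follows by
   taking some of the [B i] to be the whole line. *)
Definition mutually_independent (I : finType) (X : I -> {RV P >-> R}) : Prop :=
  forall B : I -> set R, (forall i, measurable (B i)) ->
    (P (\bigcap_i (X i @^-1` B i)) =
     \prod_(i : I) P (X i @^-1` B i))%E.

Definition has_law (X : {RV P >-> R}) (mu : probability R R) : Prop :=
  forall B : set R, measurable B -> distribution P X B = mu B.

End Probability.

Definition atomless (R : realType) (mu : probability R R) : Prop :=
  forall x : R, mu [set x]%classic = 0%E.

Definition centered (R : realType) (mu : probability R R) : Prop :=
  mu.-integrable [set: R]%classic (EFin \o idfun) /\ (\int[mu]_x x%:E = 0)%E.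

Section Disorder.
Context {dT : measure_display} {T : measurableType dT} {R : realType}.
Variables (P : probability T R) (E : finType).

(* [J] is IID with law [muJ], [eps] and [eps'] are IID with law [mueps], and
   the three fields are independent: all the variables together are mutually
   independent. *)
Definition disorder (muJ mueps : probability R R)
    (J eps eps' : E -> {RV P >-> R}) : Prop :=
  [/\ forall b, has_law (J b) muJ,
      forall b, has_law (eps b) mueps,
      forall b, has_law (eps' b) mueps &
      mutually_independent (fun k : E + (E + E) =>
        match k with
        | inl b => J b
        | inr (inl b) => eps b
        | inr (inr b) => eps' b
        end)].

(* The random couplings J + t eps, at the sample point [w]. *)
Definition perturb (J eps : E -> {RV P >-> R}) (t : R) (w : T) : E -> R :=
  fun b => J b w + t * eps b w.

End Disorder.

(* Main.v *)
(* Since A may be any event of small probability depending on J alone, it is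
   enough to bound E Q from below by a positive constant, uniformly in the box,
   the boundary condition and t < t0.

   Write s_b for the product of the spins of the ground state of J + t eps over
   the edge b, and s'_b for the same product with eps'. Given J, the variables
   s_b and s'_b are independent with the same law, so
   E[(s_b - f_b(J)) (s'_b - f_b(J))] >= 0 for every bounded f_b, that is,
   E[s_b s'_b] >= E[f_b (s_b + s'_b)] - E[f_b^2].
   For x in the box, the minimizer has a nonnegative local field:
   sum_(b ∋ x) (J_b + t eps_b) s_b >= 0. As J is atomless, with large
   probability the numbers |sum_(b ∋ x) (+/-) J_b| are at least r > 0 for all
   choices of signs and the |J_b| are at most M; call this event G. On G, for
   small t, the local field of J itself is at least r. Taking
   f_b = k J_b 1_G for a small k then bounds sum_(b ∋ x) E[s_b s'_b] from
   below. This is useful when all edges at x are inside the box, which is the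
   case for a positive fraction of the vertices as soon as n >= 3. If n = 2,
   the number of couplings is bounded, and the same anticoncentration shows
   that the ground state products do not change under a small perturbation. *)
Require Import Defs.
From HB Require Import structures.
From mathcomp Require Import all_boot all_order all_algebra finmap.
From mathcomp Require Import all_classical all_reals all_analysis.
From mathcomp Require Import measurable_realfun zify ring lra.

Set Implicit Arguments.
Unset Strict Implicit.
Unset Printing Implicit Defensive.

Import Order.TTheory GRing.Theory Num.Theory.
Import numFieldNormedType.Exports.

Local Open Scope ring_scope.

(** * Tails and concentration of a single law on the real line *)

Section RealLaw.
Local Open Scope classical_set_scope.
Variables (R : realType) (mu : probability R R).

Lemma nonincreasing_measure_small (F : (set R)^nat) (e : R) :
  (forall n, measurable (F n)) -> nonincreasing_seq F ->
  mu (\bigcap_n F n) = 0%E -> 0 < e -> exists N, (mu (F N) <= e%:E)%E.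
Proof.
move=> mF niF F0 e0.
have : mu \o F @ \oo --> mu (\bigcap_n F n).
  apply: nonincreasing_cvg_mu => //.
    by rewrite (le_lt_trans (probability_le1 _ _)) ?ltry.
  exact: bigcapT_measurable.
rewrite F0 => /fine_cvgP [_ h].
have {h} : \forall n \near \oo, `|0 - (fine \o (mu \o F)) n| < e.
  exact: cvgr_dist_lt.
case=> N _ /(_ N (leqnn _))/=; rewrite sub0r normrN => h; exists N.
rewrite -(fineK (fin_num_measure mu _ (mF N))) lee_fin.
exact: le_trans (ler_norm _) (ltW h).
Qed.

Lemma measurable_norm_gt (M : R) : measurable [set x : R | (M < `|x|)%R].
Proof.
have -> : [set x : R | M < `|x|] = ~` `[- M, M].
  apply/seteqP; split => x /=; rewrite in_itv/= -ler_norml.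
    by move=> /lt_geF ->.
  by move/negP; rewrite -ltNge.
exact: measurableC.
Qed.

Lemma measurable_real_ball (a r : R) : measurable (ball a r).
Proof. by rewrite ball_itv; exact: measurable_itv. Qed.

Lemma tail_small (e : R) : 0 < e ->
  exists2 M : R, 0 < M & (mu [set x | (M < `|x|)%R] <= e%:E)%E.
Proof.
move=> e0.
have [||||N hN] :=
  @nonincreasing_measure_small (fun n => [set x : R | (n.+1%:R < `|x|)%R]) e.
- by move=> n; exact: measurable_norm_gt.
- by move=> m n mn; apply/subsetPset => x; apply: le_lt_trans; rewrite ler_nat.
- rewrite (_ : \bigcap_n _ = set0) ?measure0//.
  rewrite -subset0 => x /(_ (Num.bound `|x|) I) /= /lt_geF/negP; apply.
  apply: (le_trans (ltW (archi_boundP (normr_ge0 x)))).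
  by rewrite ler_nat.
- exact: e0.
- by exists N.+1%:R.
Qed.

Hypothesis muA : atomless mu.

Lemma ball_small (a e : R) : 0 < e ->
  exists2 r : R, 0 < r & (mu (ball a r) <= e%:E)%E.
Proof.
move=> e0.
have [||||N hN] :=
  @nonincreasing_measure_small (fun n => ball a (n.+1%:R^-1 : R)) e.
- by move=> n; exact: measurable_real_ball.
- move=> m n mn; apply/subsetPset; apply: le_ball.
  by rewrite lef_pV2 ?posrE ?ltr0Sn// ler_nat ltnS.
- rewrite (_ : \bigcap_n _ = [set a]) ?muA//.
  apply/seteqP; split => [x|x /= ->]; last first.
    by move=> n _; apply: ballxx; rewrite invr_gt0 ltr0Sn.
  move=> Fx; apply/eqP; rewrite eq_sym -subr_eq0 -normr_eq0.
  apply/negPn/negP => xa.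
  have := Fx (Num.bound (`|a - x|^-1)) I; rewrite /ball /=.
  apply/negP; rewrite -leNgt -[leRHS]invrK lef_pV2 ?posrE ?invr_gt0 ?ltr0Sn//.
  + apply/ltW; apply: lt_trans (archi_boundP _) _; first by rewrite invr_ge0.
    by rewrite ltr_nat.
  + by rewrite lt_def xa /=.
- exact: e0.
- by exists N.+1%:R^-1; first by rewrite invr_gt0.
Qed.

(** The point is that [r] serves all centres at once. Compactness makes the radius uniform over the
    centres in a segment [[-(M + 1), M + 1]]; a ball of radius at most 1 centred outside it lies in
    the tail [M < |x|]. *)
Lemma atomless_concentration (e : R) : 0 < e ->
  exists2 r : R, 0 < r & forall a, (mu (ball a r) <= e%:E)%E.
Proof.
move=> e0; have [M M0 tM] := tail_small e0.
have /compact_near_coveringP cov := @segment_compact R (- (M + 1)) (M + 1).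
have /= : \forall r \near (0 : R)^'+,
    `[- (M + 1), M + 1] `<=` (fun a => (mu (ball a r) <= e%:E)%E).
  apply: cov => x _; have [r r0 hr] := ball_small x e0.
  (* Halving the radius keeps every ball of radius [s] about a nearby centre inside [ball x r]. *)
  exists (ball x (r / 2), [set s | s < r / 2]) => /=.
    split; first by apply: nbhsx_ballx; rewrite divr_gt0.
    by apply: nbhs_right_lt; rewrite divr_gt0.
  move=> [y s] /= [xy sr]; apply: le_trans hr; apply: le_measure; rewrite ?inE;
    [exact: measurable_real_ball..|].
  move=> z yz; rewrite [r]splitr; apply: ball_triangle xy _.
  exact: le_ball (ltW sr) _ yz.
case=> r /= r0 hr.
(* [r / 2] is strictly below [r], as the neighborhood of 0 requires; the bound 1 is for the centres
   outside the segment. *)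
pose s := Num.min (r / 2) 1.
have s0 : 0 < s by rewrite lt_min divr_gt0//=.
exists s => // a.
have [aM|aM] := leP `|a| (M + 1).
  apply: (hr s) => //=.
  - by rewrite sub0r normrN gtr0_norm// gt_min ltr_pdivrMr// ltr_pMr// ltr1n.
  - by rewrite in_itv/= -ler_norml.
apply: le_trans tM; apply: le_measure; rewrite ?inE.
- exact: measurable_real_ball.
- exact: measurable_norm_gt.
move=> x; rewrite /ball/= => ax.
have : `|a - x| < 1 by apply: lt_le_trans ax _; rewrite ge_min lexx orbT.
have : `|a| <= `|a - x| + `|x| by rewrite -{1}(subrK x a) ler_normD.
lra.
Qed.

(** Some ball of a small radius has positive mass, since countably many of them cover the line. This
    provides the event of small positive probability in the theorem. *)
Lemma atomless_small_set (e : R) : 0 < e ->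
  exists2 B : set R, measurable B & (0 < mu B <= e%:E)%E.
Proof.
move=> e0; have [r r0 hr] := atomless_concentration e0.
apply: contrapT => hB.
have mu0 a : mu (ball a r) = 0%E.
  apply/eqP/negPn/negP => h; apply: hB; exists (ball a r).
    exact: measurable_real_ball.
  by rewrite hr lt_def h measure_ge0.
(* The balls centred at the integer multiples of [r], listed through the coding of integers by
   naturals; a natural that codes no integer gets the empty set. *)
pose F (n : nat) :=
  if @choice.unpickle int n is Some k then ball (k%:~R * r : R) r else set0.
have : mu [set: R] = 0%E.
  apply/eqP; rewrite eq_le measure_ge0 andbT.
  have -> : 0%E = (\sum_(n <oo) mu (F n))%E.
    by rewrite eseries0// => n _ _; rewrite /F; case: choice.unpickle.
  apply: measure_sigma_subadditive => //.
    by move=> n; rewrite /F; case: choice.unpickle => // k; exact: measurable_real_ball.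
  move=> x _; pose k := Num.floor (x / r).
  have xr : x < (k%:~R + 1) * r by rewrite -ltr_pdivrMr// -intrD1 floorD1_gt.
  have rx : k%:~R * r <= x by rewrite -ler_pdivlMr// floor_le.
  exists (choice.pickle k); first by [].
  rewrite /F choice.pickleK /ball /= ltr_norml; apply/andP; split; lra.
by rewrite probability_setT => /eqP; rewrite onee_eq0.
Qed.

End RealLaw.

(** * Bounded measurable functions and their real-valued integrals *)

Section BoundedMeasurable.
Local Open Scope classical_set_scope.
Context {d : measure_display} {T : measurableType d} {R : realType}.
Implicit Types (f g : T -> R).

(** This class is closed under the operations used below and is integrable for every probability, so
    real-valued integrals can be manipulated without further integrability conditions. *)
Definition bounded_measurable f :=
  measurable_fun [set: T] f /\ exists M : R, forall x, `|f x| <= M.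

Lemma bounded_measurable_cst (c : R) : bounded_measurable (fun=> c).
Proof. by split; [exact: measurable_cst | exists `|c|]. Qed.

Lemma bounded_measurableD f g : bounded_measurable f -> bounded_measurable g ->
  bounded_measurable (fun x => f x + g x).
Proof.
move=> [mf [M hM]] [mg [N hN]]; split; first exact: measurable_funD.
by exists (M + N) => x; rewrite (le_trans (ler_normD _ _))// lerD.
Qed.

Lemma bounded_measurableM f g : bounded_measurable f -> bounded_measurable g ->
  bounded_measurable (fun x => f x * g x).
Proof.
move=> [mf [M hM]] [mg [N hN]]; split; first exact: measurable_funM.
by exists (M * N) => x; rewrite normrM ler_pM.
Qed.

Lemma bounded_measurableN f : bounded_measurable f ->
  bounded_measurable (fun x => - f x).
Proof.
move=> [mf [M hM]]; split; first exact: measurableT_comp.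
by exists M => x; rewrite normrN.
Qed.

Lemma bounded_measurableB f g : bounded_measurable f -> bounded_measurable g ->
  bounded_measurable (fun x => f x - g x).
Proof.
by move=> bf bg; apply: bounded_measurableD => //; exact: bounded_measurableN.
Qed.

Lemma bounded_measurable_sum (I : Type) (s : seq I) (p : pred I)
    (f : I -> T -> R) :
  (forall i, p i -> bounded_measurable (f i)) ->
  bounded_measurable (fun x => \sum_(i <- s | p i) f i x).
Proof.
move=> bf; elim: s => [|i s IHs].
  rewrite (_ : (fun _ => _) = fun=> 0); first exact: bounded_measurable_cst.
  by apply/funext => x; rewrite big_nil.
rewrite (_ : (fun _ => _) = fun x => (if p i then f i x else 0) +
    \sum_(j <- s | p j) f j x); last first.
  by apply/funext => x; rewrite big_cons; case: ifP => //; rewrite add0r.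
apply: bounded_measurableD => //; case: (boolP (p i)) => [/bf//|_].
exact: bounded_measurable_cst.
Qed.

Lemma bounded_measurable_indic (A : set T) : measurable A ->
  bounded_measurable (\1_A).
Proof.
move=> mA; split; first exact: measurable_indic.
by exists 1 => x; rewrite indicE ger0_norm// lern1 leq_b1.
Qed.

Variable P : probability T R.

Lemma bounded_measurable_integrable f : bounded_measurable f ->
  P.-integrable [set: T] (EFin \o f).
Proof.
move=> [mf [M hM]]; apply: measurable_bounded_integrable => //.
  by rewrite (le_lt_trans (probability_le1 _ _)) ?ltry.
exists M; split; first exact: num_real.
by move=> N MN x _; exact: le_trans (hM x) (ltW MN).
Qed.

Lemma expectation_Rintegral f : bounded_measurable f ->
  'E_P[f]%E = (\int[P]_w f w)%:E.
Proof.
move=> bf; rewrite unlock /Rintegral fineK//.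
exact: integrable_fin_num (bounded_measurable_integrable bf).
Qed.

Lemma Rintegral_sum (I : Type) (s : seq I) (p : pred I) (f : I -> T -> R) :
  (forall i, p i -> bounded_measurable (f i)) ->
  \int[P]_w (\sum_(i <- s | p i) f i w) = \sum_(i <- s | p i) \int[P]_w f i w.
Proof.
move=> bf; elim: s => [|i s IHs].
  under eq_Rintegral do rewrite big_nil.
  by rewrite big_nil Rintegral_cst// mul0r.
under eq_Rintegral do rewrite big_cons.
rewrite big_cons; case: ifP => // pi.
rewrite RintegralD ?IHs//; apply: bounded_measurable_integrable; first exact: bf.
exact: bounded_measurable_sum.
Qed.

Lemma Rintegral_cstT (c : R) : \int[P]_w c = c.
Proof.
rewrite Rintegral_cst//; have -> : fine (P setT) = 1; last exact: mulr1.
by have := probability_setT P => /= ->.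
Qed.

Lemma Rintegral_indic (A : set T) : measurable A ->
  \int[P]_w \1_A w = fine (P A).
Proof.
move=> mA; rewrite /Rintegral; congr fine.
by rewrite integral_indic// setIT.
Qed.

Lemma Rintegral_le f g : bounded_measurable f -> bounded_measurable g ->
  (forall x, f x <= g x) -> \int[P]_w f w <= \int[P]_w g w.
Proof.
by move=> bf bg fg; apply: le_Rintegral => //; exact: bounded_measurable_integrable.
Qed.

End BoundedMeasurable.

(** * The joint law of a finite family of real variables *)

Section JointLaw.
Local Open Scope classical_set_scope.
Variables (R : realType) (I : finType).

(** A pi-system generating the product sigma-algebra on [I -> R]; a joint law is determined by its
    values here. *)
Definition rectangles : set (set (I -> R)) :=
  [set A | exists2 B : I -> set R, (forall i, measurable (B i)) &
           A = [set x | forall i, B i (x i)]].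

Definition family := g_sigma_algebraType rectangles.

Lemma measurable_coordinate (i : I) :
  measurable_fun [set: family] (fun x : family => x i).
Proof.
move=> _ B mB; rewrite setTI; apply: sub_sigma_algebra.
exists (fun j => if j == i then B else setT).
  by move=> j; case: ifP.
apply/seteqP; split => x /= h; last by have := h i; rewrite eqxx.
by move=> j; case: eqP => // ->.
Qed.

Lemma rectangles_setI : setI_closed rectangles.
Proof.
move=> _ _ [B mB ->] [C mC ->]; exists (fun i => B i `&` C i).
  by move=> i; exact: measurableI.
apply/seteqP; split => x /=; first by move=> [hB hC] i; split.
by move=> h; split=> i; case: (h i).
Qed.

Lemma measurable_family d (T : measurableType d) (X : I -> T -> R) :
  (forall i, measurable_fun [set: T] (X i)) ->
  measurable_fun [set: T] (fun w => X ^~ w : family).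
Proof.
move=> mX; apply: (@measurability _ _ T family setT _ rectangles) => //.
move=> _ [_ [B mB ->] <-].
rewrite setTI.
have -> : (fun w => X ^~ w : family) @^-1` [set x | forall i, B i (x i)] =
    \bigcap_(i in [set: I]) (X i @^-1` B i).
  by apply/seteqP; split => w /= h i => [_|]; exact: h.
apply: fin_bigcap_measurable => [|i _]; first exact: finite_finset.
by rewrite -[X in measurable X]setTI; exact: mX.
Qed.

(** Uniqueness of measures on a pi-system, followed by a change of variables. The two families may
    live on different spaces, so an integral can be moved to a product space, where Fubini
    applies. *)
Lemma eq_joint_law d d' (T : measurableType d) (T' : measurableType d')
    (P : probability T R) (P' : probability T' R)
    (X : I -> T -> R) (Y : I -> T' -> R) (g : family -> R) :
  (forall i, measurable_fun [set: T] (X i)) ->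
  (forall i, measurable_fun [set: T'] (Y i)) ->
  (forall B : I -> set R, (forall i, measurable (B i)) ->
    P [set w | forall i, B i (X i w)] = P' [set w | forall i, B i (Y i w)]) ->
  bounded_measurable g ->
  \int[P]_w g (X ^~ w) = \int[P']_w g (Y ^~ w).
Proof.
move=> /measurable_family mX /measurable_family mY h bg.
pose fX := MeasurableFun.Pack (MeasurableFun.Class
  (isMeasurableFun.Build _ _ _ _ _ mX)).
pose fY := MeasurableFun.Pack (MeasurableFun.Class
  (isMeasurableFun.Build _ _ _ _ _ mY)).
have bgX : bounded_measurable (g \o fX).
  case: bg => mg [M hM]; split; last by exists M => w; exact: hM.
  by apply: measurableT_comp.
have bgY : bounded_measurable (g \o fY).
  case: bg => mg [M hM]; split; last by exists M => w; exact: hM.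
  by apply: measurableT_comp.
congr fine.
have mg : measurable_fun [set: family] (EFin \o g).
  by apply/measurable_EFinP; case: bg.
transitivity (\int[distribution P fX]_x (g x)%:E)%E.
  by rewrite integral_distribution//; exact: bounded_measurable_integrable.
transitivity (\int[distribution P' fY]_x (g x)%:E)%E; last first.
  by rewrite integral_distribution//; exact: bounded_measurable_integrable.
apply: eq_measure_integral => A mA _.
apply: (@measure_unique _ _ family rectangles (fun=> setT)) => //.
- exact: rectangles_setI.
- by move=> _; exists (fun=> setT) => //; apply/seteqP; split.
- by apply/seteqP; split => // x _; exists 0%N.
- by move=> _ [B mB ->]; exact: h.
- by move=> _; rewrite (le_lt_trans (probability_le1 _ _)) ?ltry.
Qed.

End JointLaw.

(** * Fubini for bounded functions on a product of two probability spaces *)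

Section ProductProbability.
Local Open Scope classical_set_scope.
Context {d1 d2 : measure_display} {T1 : measurableType d1}
  {T2 : measurableType d2} {R : realType}.
Variables (P1 : probability T1 R) (P2 : probability T2 R).

Lemma bounded_measurable_comp {d d'} {T : measurableType d}
    {T' : measurableType d'} (h : T -> T') (f : T' -> R) :
  measurable_fun [set: T] h -> bounded_measurable f ->
  bounded_measurable (fun x => f (h x)).
Proof.
move=> mh [mf [M hM]]; split; last by exists M => x; exact: hM.
by apply: measurableT_comp mf mh.
Qed.

Lemma Rintegral_prod (f : T1 * T2 -> R) : bounded_measurable f ->
  \int[(P1 \x P2)%E]_z f z = \int[P1]_x \int[P2]_y f (x, y).
Proof.
move=> bf; rewrite {1}/Rintegral.
rewrite -(integral12_prod_meas1 (m1 := P1) (m2 := P2) (f := EFin \o f)); last first.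
  exact: bounded_measurable_integrable.
congr fine; apply: eq_integral => x _ /=.
rewrite /Rintegral fineK//.
apply: integrable_fin_num => //.
apply: (@bounded_measurable_integrable _ _ _ _ (fun y => f (x, y))).
by apply: bounded_measurable_comp => //; exact: pair1_measurable.
Qed.

Lemma bounded_measurable_Rintegral (f : T1 * T2 -> R) : bounded_measurable f ->
  bounded_measurable (fun x => \int[P2]_y f (x, y)).
Proof.
move=> bf; have [mf [M hM]] := bf.
have bfx x : bounded_measurable (fun y => f (x, y)).
  by apply: bounded_measurable_comp => //; exact: pair1_measurable.
split.
  apply: measurableT_comp => //.
  exact: (@measurable_fubini_F _ _ _ _ _ P1 P2 (EFin \o f)
    (bounded_measurable_integrable _ bf)).
exists M => x; rewrite ler_norml; apply/andP; split.
  apply: (@le_trans _ _ (\int[P2]_y (- M))).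
    by rewrite Rintegral_cstT.
  apply: Rintegral_le => //; first exact: bounded_measurable_cst.
  by move=> y; have := hM (x, y); rewrite ler_norml => /andP[].
apply: (@le_trans _ _ (\int[P2]_y M)); last first.
  by rewrite Rintegral_cstT.
apply: Rintegral_le => //; first exact: bounded_measurable_cst.
by move=> y; have := hM (x, y); rewrite ler_norml => /andP[].
Qed.

End ProductProbability.

(** * Anticoncentration of signed sums of IID variables *)

Section Iid.
Local Open Scope classical_set_scope.
Context {d : measure_display} {T : measurableType d} {R : realType}.
Variables (P : probability T R) (I : finType).

Definition iid (mu : probability R R) (X : I -> {RV P >-> R}) :=
  forall B : I -> set R, (forall i, measurable (B i)) ->
    P [set w | forall i, B i (X i w)] = (\prod_i mu (B i))%E.

Lemma measurable_rectangle_preimage (X : I -> {RV P >-> R}) (B : I -> set R) :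
  (forall i, measurable (B i)) ->
  measurable [set w | forall i, B i (X i w)].
Proof.
move=> mB; have -> : [set w | forall i, B i (X i w)] =
    \bigcap_(i in [set: I]) (X i @^-1` B i).
  by apply/seteqP; split => w /= h i => [_|]; exact: h.
apply: fin_bigcap_measurable => [|i _]; first exact: finite_finset.
exact: measurable_funPTI.
Qed.

Variables (mu : probability R R) (X : I -> {RV P >-> R}).
Hypothesis iidX : iid mu X.

Lemma iid_marginal (i : I) (B : set R) : measurable B ->
  P (X i @^-1` B) = mu B.
Proof.
move=> mB.
pose B' j := if j == i then B else setT.
transitivity (P [set w | forall j, B' j (X j w)]).
  congr (P _); apply/seteqP; split => w /= h.
    by move=> j; rewrite /B'; case: eqP => // ->.
  by have := h i; rewrite /B' eqxx.
rewrite iidX => [|j]; last by rewrite /B'; case: ifP.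
rewrite (bigD1 i)//= /B' eqxx big1 ?mule1// => j /negPf ->.
exact: probability_setT.
Qed.

(* Resampling [X i] independently of the other variables reduces the bound to
   the concentration function of a single variable. *)
Lemma iid_signed_sum_concentration (c : I -> R) (i : I) (r e : R) :
  `|c i| = 1 ->
  (forall a, (mu (ball a r) <= e%:E)%E) ->
  (P [set w | (`|\sum_j c j * X j w| < r)%R] <= e%:E)%E.
Proof.
move=> ci he.
pose S := [set x : family R I | `|\sum_j c j * x j| < r].
have mS : measurable S.
  have ms : measurable_fun [set: family R I] (fun x : family R I => \sum_j c j * x j).
    apply: measurable_sum => j; apply: measurable_funM => //.
    exact: measurable_coordinate.
  have := @measurable_fun_ltr _ _ R setT
    (fun x : family R I => `|\sum_j c j * x j|) (cst r).
  move=> /(_ (measurableT_comp (@normr_measurable _ _) ms) (measurable_cst _)).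
  have mtrue : measurable [set true] by [].
  move=> /(_ measurableT [set true] mtrue); rewrite setTI; congr measurable.
pose Y (j : I) (w : T * T) := if j == i then X j w.2 else X j w.1.
have mY j : measurable_fun [set: T * T] (Y j).
  by rewrite /Y; case: (j == i); apply: measurableT_comp.
have bS := @bounded_measurable_indic _ _ R _ mS.
have law : \int[P]_w \1_S (X ^~ w : family R I) =
    \int[(P \x P)%E]_w \1_S (Y ^~ w : family R I).
  apply: eq_joint_law => // B mB.
  rewrite iidX//.
  pose B' j := if j == i then setT else B j.
  have -> : [set w | forall j, B j (Y j w)] =
    [set w | forall j, B' j (X j w)] `*` (X i @^-1` B i).
    apply/seteqP; split => -[u v] /=.
      move=> h; split => [j|]; last by have := h i; rewrite /Y eqxx.
      by rewrite /B'; case: eqP => // /eqP ji; have := h j; rewrite /Y (negPf ji).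
    move=> [h hi] j; rewrite /Y; case: eqP => [->//|/eqP ji].
    by have := h j; rewrite /B' (negPf ji).
  have mB' j : measurable (B' j) by rewrite /B'; case: ifP.
  transitivity (P [set w | forall j, B' j (X j w)] * P (X i @^-1` B i))%E.
    rewrite iidX// iid_marginal// muleC (bigD1 i)//= [in RHS](bigD1 i)//=.
    rewrite {1}/B' eqxx probability_setT mul1e; congr (_ * _)%E.
    by apply: eq_bigr => j /negPf ji; rewrite /B' ji.
  apply/esym/product_measure1E; first exact: measurable_rectangle_preimage.
  exact: measurable_funPTI.
have mSX : measurable [set w | S (X ^~ w)].
  by rewrite -[X in measurable X]setTI; exact: measurable_family.
have -> : P [set w | `|\sum_j c j * X j w| < r] =
    (\int[P]_w \1_S (X ^~ w : family R I))%:E.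
  by rewrite -[LHS](fineK (fin_num_measure P _ mSX)) -Rintegral_indic.
have bSY : bounded_measurable (fun w : T * T => \1_S (Y ^~ w : family R I) : R).
  exact: bounded_measurable_comp (measurable_family mY) bS.
rewrite law lee_fin Rintegral_prod//.
have -> : e = \int[P]_u e by rewrite Rintegral_cstT.
apply: Rintegral_le => [||u].
- exact: bounded_measurable_Rintegral P P _ bSY.
- exact: bounded_measurable_cst.
(* With the first sample point [u] frozen, the event says that [X i] at the second one lies in a
   ball of radius [r] about [- (z / c i)]; the radius is unchanged because [c i] has modulus 1. *)
pose z := \sum_(j | j != i) c j * X j u.
have ci0 : c i != 0 by rewrite -normr_eq0 ci oner_eq0.
have mb : measurable (X i @^-1` ball (- (z / c i)) r).
  by apply: measurable_funPTI; exact: measurable_real_ball.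
rewrite (_ : \int[P]_y _ = \int[P]_y \1_(X i @^-1` ball (- (z / c i)) r) y).
  rewrite Rintegral_indic//.
  have := he (- (z / c i)); rewrite -(iid_marginal i); last exact: measurable_real_ball.
  by rewrite -{1}(fineK (fin_num_measure P _ mb)) lee_fin.
have shift y : `|- (z / c i) - y| = `|c i * y + z|.
  rewrite -[LHS]mul1r -ci -normrM mulrBr mulrN mulrCA divff// mulr1.
  by rewrite -opprD normrN addrC.
apply: eq_Rintegral => v _; rewrite !indicE; congr (nat_of_bool _)%:R.
have sumY : \sum_j c j * Y j (u, v) = c i * X i v + z.
  rewrite (bigD1 i)//= {1}/Y eqxx; congr (_ + _).
  by apply: eq_bigr => j /negPf ji; rewrite /Y ji.
by apply/asboolP/asboolP; rewrite /S /ball /= sumY shift.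
Qed.

End Iid.

(** * Conditional independence of the two perturbed systems given [J] *)

Section DisorderLaw.
Local Open Scope classical_set_scope.
Context {dT : measure_display} {T : measurableType dT} {R : realType}.
Variables (P : probability T R) (E : finType) (muJ mueps : probability R R).
Variables (J eps eps' : E -> {RV P >-> R}).
Hypothesis DJ : disorder muJ mueps J eps eps'.

Let field (k : E + (E + E)) : {RV P >-> R} :=
  match k with
  | inl b => J b
  | inr (inl b) => eps b
  | inr (inr b) => eps' b
  end.

Lemma disorder_law (B : E + (E + E) -> set R) : (forall k, measurable (B k)) ->
  P [set w | forall k, B k (field k w)] =
  (\prod_b muJ (B (inl b)) *
   (\prod_b mueps (B (inr (inl b))) * \prod_b mueps (B (inr (inr b)))))%E.
Proof.
move=> mB; have [lJ le le' ind] := DJ.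
transitivity (\prod_k P (field k @^-1` B k))%E.
  rewrite -ind//; congr (P _).
  by apply/seteqP; split => w /= h k => [_|]; exact: h.
rewrite big_sumType big_sumType /=; congr (_ * (_ * _))%E; apply: eq_bigr => b _.
- exact: lJ b _ (mB _).
- exact: le b _ (mB _).
- exact: le' b _ (mB _).
Qed.

Let one (mu : probability R R) : (\prod_(b : E) mu [set: R] = 1)%E.
Proof. by rewrite big1// => b _; exact: probability_setT. Qed.

Lemma disorder_iid : [/\ iid muJ J, iid mueps eps & iid mueps eps'].
Proof.
split => B mB.
- pose C (k : E + (E + E)) := if k is inl b then B b else setT.
  transitivity (P [set w | forall k, C k (field k w)]).
    by congr (P _); apply/seteqP; split => w /= h; [case|move=> b; exact: (h (inl b))].
  rewrite disorder_law => [|[b|[b|b]]]; rewrite /C ?one ?mule1//.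
- pose C (k : E + (E + E)) := if k is inr (inl b) then B b else setT.
  transitivity (P [set w | forall k, C k (field k w)]).
    congr (P _); apply/seteqP; split => w /= h; first by case=> [|[]].
    by move=> b; exact: (h (inr (inl b))).
  rewrite disorder_law => [|[b|[b|b]]]; rewrite /C ?one ?mule1 ?mul1e//.
- pose C (k : E + (E + E)) := if k is inr (inr b) then B b else setT.
  transitivity (P [set w | forall k, C k (field k w)]).
    congr (P _); apply/seteqP; split => w /= h; first by case=> [|[]].
    by move=> b; exact: (h (inr (inr b))).
  rewrite disorder_law => [|[b|[b|b]]]; rewrite /C ?one ?mule1 ?mul1e//.
Qed.

(** A model of the disorder on a product space: [eps] is read at two independent sample points, the
    second reading standing for [eps'], which has the same law. *)
Let independent_copies (k : E + (E + E)) (w : T * (T * T)) : R :=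
  match k with
  | inl b => J b w.1
  | inr (inl b) => eps b w.2.1
  | inr (inr b) => eps b w.2.2
  end.

Let measurable_independent_copies k :
  measurable_fun [set: T * (T * T)] (independent_copies k).
Proof.
case: k => [b|[b|b]]; apply: measurableT_comp => //.
  by apply: measurableT_comp => //.
by apply: measurableT_comp => //.
Qed.

Let law_independent_copies (B : E + (E + E) -> set R) :
  (forall k, measurable (B k)) ->
  P [set w | forall k, B k (field k w)] =
  (P \x (P \x P))%E [set w | forall k, B k (independent_copies k w)].
Proof.
move=> mB; rewrite disorder_law//; have [iJ ie _] := disorder_iid.
pose AJ := [set w | forall b, B (inl b) (J b w)].
pose A1 := [set w | forall b, B (inr (inl b)) (eps b w)].
pose A2 := [set w | forall b, B (inr (inr b)) (eps b w)].
have mJ : measurable AJ.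
  exact: (measurable_rectangle_preimage J (fun b => mB (inl b))).
have m1 : measurable A1.
  exact: (measurable_rectangle_preimage eps (fun b => mB (inr (inl b)))).
have m2 : measurable A2.
  exact: (measurable_rectangle_preimage eps (fun b => mB (inr (inr b)))).
have -> : [set w | forall k, B k (independent_copies k w)] = AJ `*` (A1 `*` A2).
  apply/seteqP; split => -[u [v v']] /=.
    by move=> h; split; [|split] => b; [exact: (h (inl b)) |
      exact: (h (inr (inl b))) | exact: (h (inr (inr b)))].
  by move=> [hJ [h1 h2]] [b|[b|b]]; [exact: hJ | exact: h1 | exact: h2].
transitivity (P AJ * (P A1 * P A2))%E.
  congr (_ * (_ * _))%E; apply/esym.
  - exact: iJ (fun b => mB (inl b)).
  - exact: ie (fun b => mB (inr (inl b))).
  - exact: ie (fun b => mB (inr (inr b))).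
transitivity (P AJ * (P \x P)%E (A1 `*` A2))%E.
  by congr (_ * _)%E; rewrite -product_measure1E.
pose PP : probability (T * T)%type R := (P \x P)%E.
exact: (esym (product_measure1E P PP mJ (measurableX m1 m2))).
Qed.

(* Given [J], the fields [eps] and [eps'] are independent with the same law, so
   the expectation is that of the square of a conditional expectation. *)
Lemma conditionally_iid_product_ge0 (phi : (E -> R) -> (E -> R) -> R) :
  bounded_measurable
    (fun x : family R (E + E)%type => phi (x \o inl) (x \o inr)) ->
  0 <= \int[P]_w (phi (J ^~ w) (eps ^~ w) * phi (J ^~ w) (eps' ^~ w)).
Proof.
move=> bphi.
pose proj1 (k : E + E) (x : family R (E + (E + E))%type) : R :=
  match k with inl b => x (inl b) | inr b => x (inr (inl b)) end.
pose proj2 (k : E + E) (x : family R (E + (E + E))%type) : R :=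
  match k with inl b => x (inl b) | inr b => x (inr (inr b)) end.
have mproj1 k : measurable_fun [set: family R (E + (E + E))%type] (proj1 k).
  by case: k => b; exact: measurable_coordinate.
have mproj2 k : measurable_fun [set: family R (E + (E + E))%type] (proj2 k).
  by case: k => b; exact: measurable_coordinate.
pose g (x : family R (E + (E + E))%type) :=
  phi ((proj1 ^~ x) \o inl) ((proj1 ^~ x) \o inr) *
  phi ((proj2 ^~ x) \o inl) ((proj2 ^~ x) \o inr).
have bg : bounded_measurable g.
  apply: bounded_measurableM.
    exact: bounded_measurable_comp (measurable_family mproj1) bphi.
  exact: bounded_measurable_comp (measurable_family mproj2) bphi.
have /= law := eq_joint_law (fun k => measurable_funPT (field k))
  measurable_independent_copies law_independent_copies bg.
have -> : \int[P]_w (phi (J ^~ w) (eps ^~ w) * phi (J ^~ w) (eps' ^~ w)) =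
  \int[P]_w g (field ^~ w) by [].
rewrite law.
have bgY :=
  bounded_measurable_comp (measurable_family measurable_independent_copies) bg.
rewrite Rintegral_prod//; apply: Rintegral_ge0 => u _.
(* For fixed [u] the integrand is [psi y.1 * psi y.2], so the inner integral is the square of the
   integral of [psi]. *)
pose psi v := phi (J ^~ u) (eps ^~ v).
have bpsi : bounded_measurable psi.
  pose X (k : E + E) (v : T) : R :=
    match k with inl b => J b u | inr b => eps b v end.
  have mX k : measurable_fun [set: T] (X k).
    by case: k => b; [exact: measurable_cst | exact: measurable_funPT].
  exact: bounded_measurable_comp (measurable_family mX) bphi.
rewrite (_ : \int[_]_y _ = \int[(P \x P)%E]_y (psi y.1 * psi y.2))//.
rewrite Rintegral_prod/=; last first.
  by apply: bounded_measurableM; apply: bounded_measurable_comp => //.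
under eq_Rintegral do
  rewrite (RintegralZl _ measurableT (bounded_measurable_integrable P bpsi)).
rewrite (RintegralZr _ measurableT (bounded_measurable_integrable P bpsi)).
exact: sqr_ge0.
Qed.

End DisorderLaw.

(** * Events given by boolean conditions, and the union bound *)

Section BooleanEvents.
Local Open Scope classical_set_scope.
Context {d : measure_display} {T : measurableType d} {R : realType}.

Lemma bounded_measurable_bool (F : T -> bool) : measurable [set w | F w] ->
  bounded_measurable (fun w => (F w)%:R : R).
Proof.
move=> mF; rewrite (_ : (fun _ => _) = \1_[set w | F w]).
  exact: bounded_measurable_indic.
by apply/funext => w; rewrite indicE mem_setE.
Qed.

Lemma measurable_forall (I : finType) (p : pred I) (F : I -> T -> bool) :
  (forall i, p i -> measurable [set w | F i w]) ->
  measurable [set w | [forall i, p i ==> F i w]].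
Proof.
move=> mF.
rewrite (_ : [set w | _] = \bigcap_(i in [set` p]) [set w | F i w]).
  by apply: fin_bigcap_measurable => [|i pi]; [exact: finite_finset | exact: mF].
apply/seteqP; split => w /=.
  by move=> /forallP h i pi; have := h i; rewrite (pi : p i).
by move=> h; apply/forallP => i; apply/implyP => pi; exact: h.
Qed.

Variable P : probability T R.

(** Union bound: the indicator of a failure is at most the number of conditions that fail. *)
Lemma Rintegral_not_forall_le (I : finType) (p : pred I) (F : I -> T -> bool)
    (e : R) :
  (forall i, p i -> measurable [set w | F i w]) ->
  (forall i, p i -> (P [set w | ~~ F i w] <= e%:E)%E) ->
  \int[P]_w (~~ [forall i, p i ==> F i w])%:R <= #|p|%:R * e.
Proof.
move=> mF PF.
have mNF (G : T -> bool) : measurable [set w | G w] ->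
    measurable [set w | ~~ G w].
  move=> mG; rewrite (_ : [set w | _] = ~` [set w | G w]); first exact: measurableC.
  by apply/seteqP; split => w /= /negP.
have bNF i : p i -> bounded_measurable (fun w => (~~ F i w)%:R : R).
  by move=> pi; apply/bounded_measurable_bool/mNF/mF.
apply: (@le_trans _ _ (\int[P]_w \sum_(i | p i) (~~ F i w)%:R)).
  apply: Rintegral_le.
  - exact/bounded_measurable_bool/mNF/measurable_forall.
  - exact: bounded_measurable_sum.
  move=> w; case: (boolP [forall i, _]) => [_|]; first by rewrite sumr_ge0.
  rewrite negb_forall => /existsP[i]; rewrite negb_imply => /andP[pi Fi].
  by rewrite (bigD1 i)//= Fi lerDl sumr_ge0.
rewrite Rintegral_sum// mulr_natl -sumr_const ler_sum// => i pi.
rewrite (_ : \int[P]_w _ = fine (P [set w | ~~ F i w])).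
  rewrite -lee_fin fineK ?PF// fin_num_measure//; exact/mNF/mF.
rewrite -Rintegral_indic; last exact/mNF/mF.
by apply: eq_Rintegral => w _; rewrite indicE mem_setE.
Qed.

End BooleanEvents.

(** * Gaps of signed partial sums of the couplings *)

Section Gap.
Variables (R : realType) (E : finType).
Implicit Types (D S : {set E}) (j : E -> R).

Definition signed_sum D S j : R := \sum_(b in D) (-1) ^+ (b \in S) * j b.

(** In a pair, the first set carries the sum and the second gives the minus signs. All nonempty
    subsets of [D0] are covered, because the edges on which two ground states disagree may form any
    of them. *)
Definition gapped (D0 : {set E}) (r : R) j : bool :=
  [forall p : {set E} * {set E},
     [&& p.1 \subset D0, p.2 \subset D0 & p.1 != finset.set0] ==>
     (r <= `|signed_sum p.1 p.2 j|)].

Definition within (D0 : {set E}) (M : R) j : bool :=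
  [forall b, (b \in D0) ==> (`|j b| <= M)].

Lemma gappedP (D0 D : {set E}) (r : R) j (s : E -> R) :
  gapped D0 r j -> D \subset D0 -> D != finset.set0 ->
  (forall b, s b = 1 \/ s b = -1) ->
  r <= `|\sum_(b in D) j b * s b|.
Proof.
move=> /forallP gj DD0 D0' s1.
have /implyP/= h := gj (D, [set b in D | s b == -1]%SET).
rewrite (le_trans (h _))//.
  rewrite DD0 D0' /= andbT; apply: fintype.subset_trans DD0.
  by apply/fintype.subsetP => b; rewrite inE => /andP[].
rewrite /signed_sum le_eqVlt; apply/orP; left; apply/eqP; congr `|_|.
apply: eq_bigr => b bD; rewrite inE bD mulrC; congr (_ * _).
have [->|->] := s1 b; last by rewrite eqxx.
by rewrite -addr_eq0 -mulr2n pnatr_eq0.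
Qed.

Lemma withinP (D0 : {set E}) (M : R) j :
  reflect (forall b, b \in D0 -> `|j b| <= M) (within D0 M j).
Proof.
by apply: (iffP forallP) => h b; [move=> bD; have := h b; rewrite bD |
  apply/implyP; exact: h].
Qed.

Local Open Scope classical_set_scope.
Context {d : measure_display} {T : measurableType d}.

Lemma measurable_le_fun (f g : T -> R) : measurable_fun [set: T] f ->
  measurable_fun [set: T] g -> measurable [set w | f w <= g w].
Proof.
move=> mf mg; have mtrue : measurable [set true] by [].
by have := measurable_fun_ler mf mg measurableT mtrue; rewrite setTI.
Qed.

Lemma measurable_signed_sum D S (X : E -> T -> R) :
  (forall b, measurable_fun [set: T] (X b)) ->
  measurable_fun [set: T] (fun w => signed_sum D S (X ^~ w)).
Proof.
move=> mX; rewrite (_ : (fun w => _) = fun w =>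
    \sum_b if b \in D then (-1) ^+ (b \in S) * X b w else 0); last first.
  by apply/funext => w; rewrite /signed_sum big_mkcond.
apply: measurable_sum => b; case: (b \in D); last exact: measurable_cst.
by apply: measurable_funM; [exact: measurable_cst | exact: mX].
Qed.

Let measurable_gap_condition D S r (X : E -> T -> R) :
  (forall b, measurable_fun [set: T] (X b)) ->
  measurable [set w | r <= `|signed_sum D S (X ^~ w)|].
Proof.
move=> mX; apply: measurable_le_fun; first exact: measurable_cst.
by apply: measurableT_comp; [exact: normr_measurable | exact: measurable_signed_sum].
Qed.

Lemma measurable_gapped (D0 : {set E}) (r : R) (X : E -> T -> R) :
  (forall b, measurable_fun [set: T] (X b)) ->
  measurable [set w | gapped D0 r (X ^~ w)].
Proof.
by move=> mX; apply: measurable_forall => p _; exact: measurable_gap_condition.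
Qed.

Lemma measurable_within (D0 : {set E}) (M : R) (X : E -> T -> R) :
  (forall b, measurable_fun [set: T] (X b)) ->
  measurable [set w | within D0 M (X ^~ w)].
Proof.
move=> mX; apply: measurable_forall => b _; apply: measurable_le_fun.
  by apply: measurableT_comp; [exact: normr_measurable | exact: mX].
exact: measurable_cst.
Qed.

Variables (P : probability T R) (mu : probability R R) (X : E -> {RV P >-> R}).
Hypothesis iidX : iid mu X.

(** Union bound over the pairs of subsets of [D0], at most [4 ^+ #|D0|] in number. For each pair, an
    edge of the nonempty first set has coefficient 1 or -1, and resampling its coupling bounds the
    probability by [e]. *)
Lemma not_gapped_le (D0 : {set E}) (r e : R) :
  (forall a, (mu (ball a r) <= e%:E)%E) ->
  \int[P]_w (~~ gapped D0 r (X ^~ w))%:R <= 4 ^+ #|D0| * e.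
Proof.
move=> he; have e0 : 0 <= e by rewrite -lee_fin; apply: le_trans (he 0).
apply: (le_trans (Rintegral_not_forall_le (e := e) _ _)).
- by move=> p _; apply: measurable_gap_condition => b; exact: measurable_funPT.
- move=> [D S] /and3P[/= _ _ /set0Pn[b bD]].
  pose c i : R := if i \in D then (-1) ^+ (i \in S) else 0.
  apply: le_trans (iid_signed_sum_concentration (c := c) (i := b) iidX _ he).
    rewrite le_eqVlt; apply/orP; left; apply/eqP; congr (P _).
    have sumc w : signed_sum D S (X ^~ w) = \sum_j c j * X j w.
      rewrite /signed_sum big_mkcond; apply: eq_bigr => i _.
      by rewrite /c; case: ifP => _; rewrite ?mul0r.
    by apply/seteqP; split => w /=; rewrite -ltNge sumc.
  by rewrite /c bD normr_sign.
apply: ler_wpM2r => //.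
have -> : 4 ^+ #|D0| = (2 ^ #|D0| * 2 ^ #|D0|)%N%:R :> R.
  by rewrite natrM !natrX -exprMn -natrM.
rewrite ler_nat -card_powerset -cardsX; apply: subset_leq_card.
by apply/fintype.subsetP => -[D S] /and3P[/= DD SD _]; rewrite !inE/= DD.
Qed.

Lemma not_within_le (D0 : {set E}) (M e : R) :
  (mu [set x | (M < `|x|)%R] <= e%:E)%E ->
  \int[P]_w (~~ within D0 M (X ^~ w))%:R <= #|D0|%:R * e.
Proof.
move=> he; apply: Rintegral_not_forall_le => b _.
  apply: measurable_le_fun; last exact: measurable_cst.
  by apply: measurableT_comp; [exact: normr_measurable | exact: measurable_funPT].
rewrite (_ : [set w | _] = X b @^-1` [set x | (M < `|x|)%R]).
  by rewrite (iid_marginal iidX)//; exact: measurable_norm_gt.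
by apply/seteqP; split => w /=; rewrite -ltNge.
Qed.

End Gap.

(** * Edges and stars of the lattice, and double counting *)

Section Lattice.
Variable d : nat.
Implicit Types (x y : vertex d) (V L : {fset vertex d}) (b : {fset vertex d}).

Lemma neighborsP x y :
  reflect (exists i : 'I_d, y = x + unit_vec i \/ y = x - unit_vec i)
          (y \in neighbors x).
Proof.
rewrite /neighbors in_fsetU; apply: (iffP orP).
  by move=> [/imfsetP[i _ ->]|/imfsetP[i _ ->]]; exists i; [left|right].
by move=> [i [->|->]]; [left|right]; apply/imfsetP; exists i.
Qed.

Lemma neighbors_sym x y : (y \in neighbors x) = (x \in neighbors y).
Proof.
apply/neighborsP/neighborsP => -[i [->|->]]; exists i;
  rewrite ?addrK ?subrK; by [left|right].
Qed.

Lemma unit_vec_neq0 (i : 'I_d) : unit_vec i != 0.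
Proof.
by apply/eqP => /matrixP/(_ 0 i); rewrite !mxE !eqxx => /eqP; rewrite oner_eq0.
Qed.

Lemma neighbors_irr x : x \notin neighbors x.
Proof.
apply/neighborsP => -[i [] /eqP].
  by rewrite -subr_eq0 opprD addrA subrr sub0r oppr_eq0 (negPf (unit_vec_neq0 i)).
by rewrite -subr_eq0 opprB addrC subrK (negPf (unit_vec_neq0 i)).
Qed.

Lemma card_neighbors_le x : (#|` neighbors x| <= 2 * d)%N.
Proof.
rewrite /neighbors cardfsU (leq_trans (leq_subr _ _))// mul2n -addnn leq_add//;
  by rewrite (leq_trans (leq_imfset_card _ _ _))//= -cardE card_ord.
Qed.

Lemma edgesP V b :
  reflect (exists x y, [/\ x \in V, y \in V, y \in neighbors x & b = [fset x; y]%fset])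
          (b \in edges V).
Proof.
apply: (iffP idP).
  case/imfset2P => x xV [y]; rewrite inE => /andP[yV xy] ->.
  by exists x, y; split.
move=> [x [y [xV yV xy ->]]]; apply/imfset2P; exists x => //; exists y => //.
by rewrite inE; apply/andP; split.
Qed.

Lemma card_edge V b : b \in edges V -> #|` b| = 2%N.
Proof.
case/edgesP => x [y [_ _ xy ->]]; rewrite cardfs2; case: eqP => // xyE.
by move: xy; rewrite xyE (negPf (neighbors_irr y)).
Qed.

Lemma edge_endpoints V b x : b \in edges V -> x \in b ->
  [/\ x \in V & exists2 y, y \in neighbors x & y \in V /\ b = [fset x; y]%fset].
Proof.
case/edgesP => u [v [uV vV uv ->]]; rewrite in_fset2 => /orP[|] /eqP ->.
  by split=> //; exists v.
by split=> //; exists u; rewrite 1?neighbors_sym// fsetUC.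
Qed.

Lemma edgesS V W : (V `<=` W)%fset -> (edges V `<=` edges W)%fset.
Proof.
move=> /fsubsetP VW; apply/fsubsetP => b /edgesP[x [y [xV yV xy ->]]].
by apply/edgesP; exists x, y; split => //; exact: VW.
Qed.

Lemma edges_sub_closed L : (edges L `<=` closed_edges L)%fset.
Proof. by apply: edgesS; exact: fsubsetUl. Qed.

Lemma card_edges_le V : (#|` edges V| <= #|` V| * #|` V|)%N.
Proof.
rewrite -(size_allpairs (fun x y => [fset x; y]%fset)).
apply: uniq_leq_size; first exact: fset_uniq.
move=> b /edgesP[x [y [xV yV _ ->]]].
by apply/allpairsP; exists (x, y).
Qed.

(** Edges from [u] to the boundary are included: they too enter the local field at [u]. *)
Definition star L (u : L) : {set closed_edges L} :=
  [set b : closed_edges L | val u \in val b].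

Lemma card_star_le L (u : L) : (#|star u| <= 2 * d)%N.
Proof.
apply: leq_trans (card_neighbors_le (val u)).
pose A := [fset [fset val u; y] | y in neighbors (val u)]%fset.
apply: (@leq_trans #|` A|); last by rewrite (leq_trans (leq_imfset_card _ _ _)).
rewrite cardE -(size_map val) uniq_leq_size ?(map_inj_uniq val_inj) ?enum_uniq//.
move=> b /mapP[e]; rewrite mem_enum inE => ue ->.
have [_ [y uy [_ ->]]] := edge_endpoints (valP e) ue.
by apply/imfsetP; exists y.
Qed.

Lemma star_gt0 L (u : L) : (0 < d)%N -> star u != finset.set0.
Proof.
move=> d0; pose i0 := Ordinal d0; pose y := val u + unit_vec i0.
have uy : y \in neighbors (val u) by apply/neighborsP; exists i0; left.
have bE : [fset val u; y]%fset \in closed_edges L.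
  apply/edgesP; exists (val u), y; split => //.
    by rewrite in_fsetU (valP u).
  rewrite in_fsetU; have [//|yL] := boolP (y \in L).
  rewrite in_fsetD yL; apply/bigfcupP; exists (val u) => //.
  by rewrite (valP u).
apply/set0Pn; exists (FSetSub bE : closed_edges L).
by rewrite inE /= in_fset2 eqxx.
Qed.

Lemma sum_edges (R : pzRingType) L (F : {fset vertex d} -> R) :
  \sum_(b <- edges L) F b = \sum_(b : closed_edges L | val b \in edges L) F (val b).
Proof.
rewrite -(big_seq_fsetE _ _ (fun b => b \in edges L)) /= [RHS]big_mkcond /=.
rewrite -(big_fset_incl _ (edges_sub_closed L)) => [|b _ /negPf -> //].
by apply: eq_big_seq => b ->.
Qed.

(** An edge inside [L] has exactly two endpoints, both in [L], hence belongs to exactly two stars.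
    This converts bounds on stars into bounds on the overlap. *)
Lemma double_count (R : pzRingType) L (F : closed_edges L -> R) :
  2 * \sum_(b : closed_edges L | val b \in edges L) F b =
  \sum_(u : L) \sum_(b in star u | val b \in edges L) F b.
Proof.
under [RHS]eq_bigr do rewrite big_mkcond.
rewrite exchange_big /= mulr_sumr big_mkcond; apply: eq_bigr => b _.
under eq_bigr do rewrite inE.
case: ifP => bL; last first.
  by rewrite big1// => u _; rewrite andbF.
under eq_bigr do rewrite andbT.
rewrite -big_mkcond /= sumr_const -[RHS]mulr_natl.
congr (_%:R * _); rewrite -(card_edge bL) cardE -[RHS](size_map val).
apply/perm_size/uniq_perm; rewrite ?(map_inj_uniq val_inj) ?enum_uniq ?fset_uniq//.
move=> x; apply/idP/mapP => [xb|[u]]; last by rewrite mem_enum => ub ->.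
have [xL _] := edge_endpoints bL xb.
by exists (FSetSub xL); rewrite // mem_enum.
Qed.

Lemma card_edges_le_degree (R : numDomainType) L :
  2 * #|` edges L|%:R <= (2 * d)%:R * #|` L|%:R :> R.
Proof.
have -> : #|` edges L|%:R = \sum_(b : closed_edges L | val b \in edges L) 1 :> R.
  by rewrite -(sum_edges _ (fun=> 1)) big_const_seq count_predT iter_addr_0.
rewrite double_count.
apply: (@le_trans _ _ (\sum_(u : L) (2 * d)%:R)); last first.
  by rewrite sumr_const -cardfE mulr_natr.
apply: ler_sum => u _; apply: (@le_trans _ _ (\sum_(b in star u) 1)); last first.
  by rewrite sumr_const ler_nat card_star_le.
by rewrite big_mkcondr ler_sum// => b _; case: ifP.
Qed.

(** * Boxes, their enlargements and their interiors *)

Section Box.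

Definition ones (k : int) : vertex d := const_mx k.

Lemma in_box (a : vertex d) (n : nat) x :
  reflect (forall i, 1 <= x 0 i - a 0 i <= n%:Z) (x \in box a n).
Proof.
rewrite /box; apply: (iffP (imfsetP _ _ _ _)) => [[f _ ->] i|h].
  rewrite /box_point !mxE; have := ltn_ord (f i).
  by move: (a 0 i) (nat_of_ord (f i)) => p q; lia.
have hn i : (`|(x 0 i - a 0 i)%R|.-1 < n)%N.
  by have := h i; lia.
exists [ffun i => Ordinal (hn i)] => //.
apply/matrixP => i j; rewrite ord1 !mxE ffunE /=.
by have := h j; lia.
Qed.

Lemma card_box (a : vertex d) n : #|` box a n| = (n ^ d)%N.
Proof.
rewrite card_imfset/=; last first.
  move=> f g /matrixP fg; apply/ffunP => i; have := fg 0 i.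
  by rewrite /box_point !mxE => /addrI/eqP; rewrite eqz_nat eqSS => /eqP/val_inj.
by rewrite -cardE card_ffun !card_ord.
Qed.

Lemma neighbors_box (a : vertex d) n x y : x \in box a n -> y \in neighbors x ->
  y \in box (a - ones 1) n.+2.
Proof.
move=> /in_box hx /neighborsP[i yE]; apply/in_box => j; have := hx j.
have : -1 <= y 0 j - x 0 j <= 1.
  case: yE => ->; rewrite /unit_vec !mxE; move: (x 0 j) => p;
    by rewrite eqxx /=; case: (j == i); rewrite ?mulr1n ?mulr0n; lia.
rewrite /ones !mxE; move: (y 0 j) (x 0 j) (a 0 j) => p q r; lia.
Qed.

Lemma box_sub (a : vertex d) n : (box a n `<=` box (a - ones 1) n.+2)%fset.
Proof.
apply/fsubsetP => x /in_box hx; apply/in_box => j; have := hx j.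
by rewrite /ones !mxE; move: (x 0 j) (a 0 j) => p q; lia.
Qed.

(** A box together with its boundary fits in the concentric box of side [n.+2]. The crude count of
    pairs of vertices suffices, as it serves only for side 2. *)
Lemma card_closed_edges_box (a : vertex d) n :
  (#|` closed_edges (box a n)| <= n.+2 ^ d * n.+2 ^ d)%N.
Proof.
rewrite -(card_box (a - ones 1)); apply: leq_trans (card_edges_le _).
apply/fsubset_leq_card/edgesS; rewrite fsubUset box_sub /=.
apply/fsubsetP => y; rewrite in_fsetD => /andP[_ /bigfcupP[x]].
by rewrite andbT => xL /(neighbors_box xL).
Qed.

(** [box (a + ones 1) m] is the box with its outer layer removed, so all neighbors of its points
    stay in the box. *)
Lemma star_interior (a : vertex d) m (u : box a m.+2) (b : closed_edges (box a m.+2)) :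
  val u \in box (a + ones 1) m -> b \in star u -> val b \in edges (box a m.+2).
Proof.
move=> uI; rewrite inE => ub.
have [_ [y uy [_ ->]]] := edge_endpoints (valP b) ub.
apply/edgesP; exists (val u), y; split => //; first exact: valP.
by have := neighbors_box uI uy; rewrite addrK.
Qed.

Lemma sum_interior (R : pzRingType) (a : vertex d) m (c : R) :
  \sum_(u : box a m.+2) (if val u \in box (a + ones 1) m then c else 0) =
  c *+ m ^ d.
Proof.
have sub : (box (a + ones 1) m `<=` box a m.+2)%fset.
  by have := box_sub (a + ones 1) m; rewrite addrK.
rewrite -(big_seq_fsetE _ _ xpredT
  (fun x => if x \in box (a + ones 1) m then c else 0)) /=.
rewrite -(big_fset_incl _ sub) => [|x _ /negPf -> //].
rewrite (eq_big_seq (fun=> c)) => [|x -> //].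
by rewrite big_const_seq count_predT iter_addr_0 card_box.
Qed.

Lemma edges_box_neq0 (a : vertex d) n : (0 < d)%N -> (2 <= n)%N ->
  (0 < #|` edges (box a n)|)%N.
Proof.
move=> d0 n2; pose i0 := Ordinal d0; pose x := a + ones 1; pose y := x + unit_vec i0.
rewrite cardfs_gt0; apply/fset0Pn; exists [fset x; y]%fset.
apply/edgesP; exists x, y; split => //.
- apply/in_box => j; rewrite /x /ones !mxE; move: (a 0 j) => p; lia.
- apply/in_box => j; rewrite /y /x /ones /unit_vec !mxE eqxx /=.
  by move: (a 0 j) => p; case: (j == i0); rewrite ?mulr1n ?mulr0n; lia.
- by apply/neighborsP; exists i0; left.
Qed.

End Box.
End Lattice.

(** * Local fields, stability and measurability of the ground state *)

Section GroundState.
Variables (R : realType) (d : nat) (L : {fset vertex d}) (bc : vertex d -> bool).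
Implicit Types (s : {ffun L -> bool}) (K : closed_edges L -> R).

Definition edge_spin s (b : {fset vertex d}) : R :=
  \prod_(x <- b) spin R bc s x.

Lemma edge_spin_sign s b : edge_spin s b = 1 \/ edge_spin s b = -1.
Proof.
rewrite /edge_spin; elim/big_ind: _ => [|x y [->|->] [->|->]|x _].
- by left.
- by left; rewrite mulr1.
- by right; rewrite mul1r.
- by right; rewrite mulr1.
- by left; rewrite mulrNN mulr1.
- by rewrite /spin; case: insub => [v|]; [case: (s v)|case: (bc x)];
    [right|left|right|left].
Qed.

Lemma normr_edge_spin s b : `|edge_spin s b| = 1.
Proof. by have [->|->] := edge_spin_sign s b; rewrite ?normrN normr1. Qed.

Lemma hamiltonianE K s : hamiltonian bc K s = - \sum_b K b * edge_spin s (val b).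
Proof.
by rewrite /hamiltonian -sumrN; apply: eq_bigr => b _; rewrite mulNr.
Qed.

Lemma ground_state_max K s :
  \sum_b K b * edge_spin s (val b) <=
  \sum_b K b * edge_spin (ground_state bc K) (val b).
Proof.
rewrite -lerN2 -!hamiltonianE /ground_state.
by case: Order.TotalTheory.arg_minP => // s0 _; apply.
Qed.

Definition flip (u : L) s : {ffun L -> bool} :=
  [ffun v => if v == u then ~~ s v else s v].

Lemma spin_flip (u : L) s x :
  spin R bc (flip u s) x = (if x == val u then -1 else 1) * spin R bc s x.
Proof.
rewrite /spin; case: insubP => [v _ <-|xL].
  rewrite ffunE (inj_eq val_inj); case: eqP => _; rewrite ?mul1r//.
  by case: (s v); rewrite /= ?expr0 ?expr1 ?mulN1r ?opprK ?mulr1.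
by case: eqP => [xu|_]; rewrite ?mul1r//; move: xL; rewrite xu (valP u).
Qed.

Lemma edge_spin_flip (u : L) s b :
  edge_spin (flip u s) b = (if val u \in b then -1 else 1) * edge_spin s b.
Proof.
rewrite /edge_spin; under eq_bigr do rewrite spin_flip.
rewrite big_split /=; congr (_ * _).
rewrite -big_mkcond /= big_const_seq /= count_uniq_mem ?fset_uniq//.
by case: (val u \in b) => /=; rewrite ?mulr1.
Qed.

(** Flipping the spin at [u] reverses exactly the edge products in the star, so twice this sum is
    the energy cost of the flip. *)
Lemma ground_state_local_field K (u : L) :
  0 <= \sum_(b in star u) K b * edge_spin (ground_state bc K) (val b).
Proof.
set s := ground_state bc K.
have := ground_state_max K (flip u s); rewrite -/s.
rewrite -subr_ge0 -sumrB.
rewrite (eq_bigr (fun b : closed_edges L => if b \in star u then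
    2 * (K b * edge_spin s (val b)) else 0)); last first.
  by move=> b _; rewrite edge_spin_flip inE; case: ifP => _; ring.
by rewrite -big_mkcond -mulr_sumr pmulr_rge0.
Qed.

Lemma perturbation_sum_le (D : {set closed_edges L}) (eps : closed_edges L -> R)
    (t K0 : R) (s : {ffun L -> bool}) :
  0 <= t -> within D K0 eps ->
  `|\sum_(b in D) t * eps b * edge_spin s (val b)| <= t * (#|D|%:R * K0).
Proof.
move=> t0 /withinP weps.
rewrite (eq_bigr (fun b : closed_edges L => t * (eps b * edge_spin s (val b))));
  last first.
  by move=> b _; rewrite mulrA.
rewrite -mulr_sumr normrM (ger0_norm t0) ler_wpM2l// (le_trans (ler_norm_sum _ _ _))//.
rewrite mulr_natl -sumr_const ler_sum// => b bD.
by rewrite normrM normr_edge_spin mulr1 weps.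
Qed.

(* The local field at [u] is nonnegative for the perturbed couplings, hence
   almost nonnegative for [J]; the gap then excludes small values. *)
Lemma gapped_local_field (J eps : closed_edges L -> R) (t r K0 : R) (u : L) :
  star u != finset.set0 -> gapped (star u) r J -> within (star u) K0 eps ->
  0 <= t -> t * (#|star u|%:R * K0) < r ->
  r <= \sum_(b in star u) J b *
         edge_spin (ground_state bc (fun b => J b + t * eps b)) (val b).
Proof.
move=> star0 gJ weps t0 tK; set s := ground_state _ _.
have := gappedP gJ (fintype.subxx _) star0 (fun b => edge_spin_sign s (val b)).
have := perturbation_sum_le s t0 weps.
have := ground_state_local_field (fun b => J b + t * eps b) u; rewrite -/s.
under eq_bigr do rewrite mulrDl.
rewrite big_split /=; set A := \sum_(b in _) J b * _; set B := \sum_(b in _) _.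
move=> AB Bt; rewrite ler_normr => /orP[//|rA].
by have := le_trans (ler_norm B) Bt; lra.
Qed.

(** Let [D] be the set of edges where the two products differ. For any couplings, the energy
    difference of the two configurations is twice a signed sum over [D]. For [J] this sum is
    nonnegative, hence at least [r] by the gap if [D] is nonempty; for the perturbed couplings it is
    at most 0, and the perturbation is too small to bridge [r]. *)
Lemma gapped_stable (J eps : closed_edges L -> R) (t r K0 : R) :
  gapped finset.setT r J -> within finset.setT K0 eps -> 0 <= t -> 0 <= K0 ->
  t * (#|{: closed_edges L}|%:R * K0) < r ->
  forall b : closed_edges L,
    edge_spin (ground_state bc (fun b => J b + t * eps b)) (val b) =
    edge_spin (ground_state bc J) (val b).
Proof.
move=> gJ weps t0 K00 tK b0; set s := ground_state bc J; set s' := ground_state _ _.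
pose D := [set b : closed_edges L | edge_spin s' (val b) != edge_spin s (val b)].
have [/setP/(_ b0)|D0] := eqVneq D finset.set0.
  by rewrite !inE => /negPn/eqP.
exfalso.
have diff K : \sum_b K b * edge_spin s (val b) - \sum_b K b * edge_spin s' (val b)
    = 2 * \sum_(b in D) K b * edge_spin s (val b).
  rewrite -sumrB mulr_sumr [RHS]big_mkcond; apply: eq_bigr => b _.
  rewrite inE; case: eqP => [->|]; first by rewrite subrr.
  have [->|->] := edge_spin_sign s (val b);
    have [->|->] := edge_spin_sign s' (val b) => // _; ring.
have := ground_state_max J s'; rewrite -subr_ge0 -/s diff pmulr_rge0// => hJ.
have := ground_state_max (fun b => J b + t * eps b) s; rewrite -subr_le0 -/s' diff.
rewrite pmulr_rle0//; under eq_bigr do rewrite mulrDl.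
rewrite big_split /=.
have weps' : within D K0 eps.
  by apply/withinP => b _; apply: (withinP _ _ _ weps); rewrite inE.
have := perturbation_sum_le s t0 weps'.
have := gappedP gJ (finset.subsetT D) D0 (fun b => edge_spin_sign s (val b)).
rewrite (ger0_norm hJ) ler_norml => rA /andP[Bt _] AB.
suff : t * (#|D|%:R * K0) < r by lra.
by apply: le_lt_trans tK; rewrite ler_wpM2l// ler_wpM2r// ler_nat max_card.
Qed.

(** Edges of [edges L] see only spins in [L], so the dummy boundary condition can be replaced by
    [bc]. *)
Lemma overlapE (s s' : {ffun L -> bool}) :
  overlap R s s' =
  (#|` edges L|%:R)^-1 * \sum_(b <- edges L) edge_spin s b * edge_spin s' b.
Proof.
have spinE s0 x : x \in L -> spin R (fun=> false) s0 x = spin R bc s0 x.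
  by move=> xL; rewrite /spin insubT.
rewrite /overlap; congr (_ * _); apply: eq_big_seq => b bL.
rewrite /edge_spin -big_split /=; apply: eq_big_seq => x xb.
by have [xL _] := edge_endpoints bL xb; rewrite !spinE.
Qed.

Lemma normr_overlap_le1 (s s' : {ffun L -> bool}) : `|overlap R s s'| <= 1.
Proof.
rewrite overlapE normrM normfV normr_nat.
apply: (@le_trans _ _ ((#|` edges L|%:R)^-1 * \sum_(b <- edges L) 1)).
  rewrite ler_wpM2l ?invr_ge0// (le_trans (ler_norm_sum _ _ _))// ler_sum// => b _.
  by rewrite normrM !normr_edge_spin mulr1.
rewrite big_const_seq count_predT iter_addr_0.
by have [->|n0] := eqVneq #|` edges L| 0%N; rewrite ?mulr0// mulVf// pnatr_eq0.
Qed.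

Local Open Scope classical_set_scope.

(* The ground state depends on the couplings only through the finite table of
   comparisons between energies. *)
Lemma bounded_measurable_ground_state {dT : measure_display}
    {T : measurableType dT} (K : closed_edges L -> T -> R)
    (h : {ffun L -> bool} -> R) :
  (forall b, measurable_fun [set: T] (K b)) ->
  bounded_measurable (fun w => h (ground_state bc (K ^~ w))).
Proof.
move=> mK; pose config := {ffun L -> bool}.
pose H w (s : config) := hamiltonian bc (K ^~ w) s.
pose table w : {ffun config * config -> bool} := [ffun p => H w p.1 <= H w p.2].
pose G (tb : {ffun config * config -> bool}) : config :=
  odflt [ffun=> false] [pick s | [forall s', tb (s, s')]].
have gsG w : ground_state bc (K ^~ w) = G (table w).
  rewrite /ground_state /G /Order.arg_min /extremum; congr odflt.
  by apply: eq_pick => s /=; apply: eq_forallb => s'; rewrite ffunE.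
(* A finite sum over all conceivable tables [tb]: the value for [tb] times the indicator that [tb]
   is the actual table. *)
rewrite (_ : (fun w => _) = fun w =>
    \sum_tb h (G tb) * [forall p, true ==> ((H w p.1 <= H w p.2) == tb p)]%:R);
    last first.
  apply/funext => w; rewrite gsG (bigD1 (table w))//= big1 => [|tb tbw].
    rewrite (_ : [forall p, _]) ?mulr1 ?addr0//.
    by apply/forallP => p; rewrite ffunE eqxx.
  rewrite (_ : [forall p, _] = false) ?mulr0//.
  apply/negbTE; apply: contra tbw => /forallP eqtb.
  by apply/eqP/ffunP => p; have /eqP := eqtb p; rewrite ffunE.
apply: bounded_measurable_sum => tb _; apply: bounded_measurableM.
  exact: bounded_measurable_cst.
apply: bounded_measurable_bool; apply: measurable_forall => p _.
have mH s : measurable_fun [set: T] (fun w => H w s).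
  rewrite (_ : (fun w => _) = fun w => \sum_b - K b w * edge_spin s (val b)).
    apply: measurable_sum => b; apply: measurable_funM; last exact: measurable_cst.
    exact: measurableT_comp.
  by apply/funext => w.
have mle : measurable [set w | H w p.1 <= H w p.2] by exact: measurable_le_fun.
case: (tb p); first by rewrite (_ : [set w | _] = [set w | H w p.1 <= H w p.2])//;
  apply/seteqP; split => w /= /eqP.
rewrite (_ : [set w | _] = ~` [set w | H w p.1 <= H w p.2]).
  exact: measurableC.
by apply/seteqP; split => w /=; case: (_ <= _).
Qed.

End GroundState.

(** * Lower bounds for the expected overlap *)

Section Estimates.
Context {dT : measure_display} {T : measurableType dT} {R : realType}.
Variable P : probability T R.

(** The common shape of the two estimates below: [c] is the gain, the [A]'s indicate failures of [J]
    and the [B]'s failures of the perturbations. *)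
Lemma Rintegral_ge_affine (f S A1 A2 B1 B2 : T -> R) (c a b : R) :
  bounded_measurable f -> bounded_measurable S ->
  bounded_measurable A1 -> bounded_measurable A2 ->
  bounded_measurable B1 -> bounded_measurable B2 ->
  (forall w, S w + c - (a * (A1 w + A2 w) + b * (B1 w + B2 w)) <= f w) ->
  \int[P]_w S w + c - (a * (\int[P]_w A1 w + \int[P]_w A2 w) +
                       b * (\int[P]_w B1 w + \int[P]_w B2 w)) <=
  \int[P]_w f w.
Proof.
move=> bf bS bA1 bA2 bB1 bB2 le_f.
have bc x : bounded_measurable (fun _ : T => x : R) by exact: bounded_measurable_cst.
have bA := bounded_measurableD bA1 bA2; have bB := bounded_measurableD bB1 bB2.
have baA := bounded_measurableM (bc a) bA; have bbB := bounded_measurableM (bc b) bB.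
have bAB := bounded_measurableD baA bbB; have bSc := bounded_measurableD bS (bc c).
apply: le_trans (Rintegral_le P (bounded_measurableB bSc bAB) bf le_f).
have int f0 (bf0 : bounded_measurable f0) := bounded_measurable_integrable P bf0.
rewrite (RintegralB _ (int _ bSc) (int _ bAB))//.
rewrite (RintegralD _ (int _ bS) (int _ (bc c)))//.
rewrite (RintegralD _ (int _ baA) (int _ bbB))//.
rewrite (RintegralZl _ _ (int _ bA))// (RintegralZl _ _ (int _ bB))//.
rewrite (RintegralD _ (int _ bA1) (int _ bA2))//.
rewrite (RintegralD _ (int _ bB1) (int _ bB2))//.
by rewrite Rintegral_cstT.
Qed.

Variables (d : nat) (L : {fset vertex d}) (bc : vertex d -> bool).
Variables (muJ mueps : probability R R).
Variables (J eps eps' : closed_edges L -> {RV P >-> R}).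
Hypothesis DJ : disorder muJ mueps J eps eps'.
(** [N] bounds the number of edges treated at once: a star, or all edges when the side is 2. On such
    a set the gap fails with probability at most [1 / 8], the bound [M] on [J] with at most [1 / 4],
    and the bound [K0] on each perturbation with at most [N%:R * eK]; [t_small] keeps the
    perturbation below the gap. *)
Variables (N : nat) (r M K0 eJ eM eK t : R).
Hypotheses (r0 : 0 < r) (M0 : 0 < M) (K00 : 0 < K0) (t0 : 0 <= t).
Hypothesis muJ_ball : forall a, (muJ (ball a r) <= eJ%:E)%E.
Hypothesis eJ_small : 4 ^+ N * eJ <= 1 / 8.
Hypothesis muJ_tail : (muJ [set x | (M < `|x|)%R]%classic <= eM%:E)%E.
Hypothesis eM_small : N%:R * eM <= 1 / 4.
Hypothesis mueps_tail : (mueps [set x | (K0 < `|x|)%R]%classic <= eK%:E)%E.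
Hypothesis eK_small : N%:R * eK <= 1 / 8.
Hypothesis eK_small' : N%:R * eK * (r + N%:R * M) <= r / 8.
Hypothesis t_small : t * (N%:R * K0) < r.

Let X (b : closed_edges L) (w : T) : R :=
  edge_spin R bc (ground_state bc (perturb J eps t w)) (val b).
Let X' (b : closed_edges L) (w : T) : R :=
  edge_spin R bc (ground_state bc (perturb J eps' t w)) (val b).

Let bX b : bounded_measurable (X b).
Proof.
apply: (bounded_measurable_ground_state bc
  (K := fun b w => J b w + t * eps b w) (fun s => edge_spin R bc s (val b))).
by move=> b'; apply: measurable_funD => //; apply: measurable_funM.
Qed.

Let bX' b : bounded_measurable (X' b).
Proof.
apply: (bounded_measurable_ground_state bc
  (K := fun b w => J b w + t * eps' b w) (fun s => edge_spin R bc s (val b))).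
by move=> b'; apply: measurable_funD => //; apply: measurable_funM.
Qed.

Let not_gapped_small (D : {set closed_edges L}) : (#|D| <= N)%N ->
  \int[P]_w (~~ gapped D r (J ^~ w))%:R <= 1 / 8.
Proof.
move=> DN; have [iJ _ _] := disorder_iid DJ.
apply: le_trans eJ_small; apply: le_trans (not_gapped_le iJ _ muJ_ball) _.
have eJ0 : 0 <= eJ by rewrite -lee_fin; apply: le_trans (muJ_ball 0).
by rewrite ler_wpM2r// ler_weXn2l// ler1n.
Qed.

Let not_withinJ_small (D : {set closed_edges L}) : (#|D| <= N)%N ->
  \int[P]_w (~~ within D M (J ^~ w))%:R <= 1 / 4.
Proof.
move=> DN; have [iJ _ _] := disorder_iid DJ.
apply: le_trans eM_small; apply: le_trans (not_within_le iJ _ muJ_tail) _.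
have eM0 : 0 <= eM by rewrite -lee_fin; apply: le_trans muJ_tail.
by rewrite ler_wpM2r// ler_nat.
Qed.

Let not_within_small (D : {set closed_edges L}) : (#|D| <= N)%N ->
  \int[P]_w (~~ within D K0 (eps ^~ w))%:R <= N%:R * eK /\
  \int[P]_w (~~ within D K0 (eps' ^~ w))%:R <= N%:R * eK.
Proof.
move=> DN; have [_ ie ie'] := disorder_iid DJ.
have eK0 : 0 <= eK by rewrite -lee_fin; apply: le_trans mueps_tail.
split; [apply: le_trans (not_within_le ie _ mueps_tail) _
       |apply: le_trans (not_within_le ie' _ mueps_tail) _];
  by rewrite ler_wpM2r// ler_nat.
Qed.

Let bnot {d' : measure_display} {U : measurableType d'} (F : U -> bool) :
  measurable [set w | F w]%classic -> bounded_measurable (fun w => (~~ F w)%:R : R).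
Proof.
move=> mF; apply: bounded_measurable_bool.
rewrite (_ : [set w | _]%classic = (~` [set w | F w])%classic).
  exact: measurableC.
by apply/seteqP; split => w /= /negP.
Qed.

Let good (D : {set closed_edges L}) (j : closed_edges L -> R) : bool :=
  gapped D r j && within D M j.

(** The difference [s_b - f_b(J)] with [f_b = k J_b] on the good event and 0 off it. *)
Let phi (k : R) (D : {set closed_edges L}) (b : closed_edges L)
    (j e : closed_edges L -> R) : R :=
  edge_spin R bc (ground_state bc (fun b => j b + t * e b)) (val b) -
  k * (j b * (good D j)%:R).

Let bphi (k : R) (D : {set closed_edges L}) (b : closed_edges L) :
  b \in D ->
  forall (dU : measure_display) (U : measurableType dU)
    (j e : closed_edges L -> U -> R),
  (forall b, measurable_fun [set: U]%classic (j b)) ->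
  (forall b, measurable_fun [set: U]%classic (e b)) ->
  bounded_measurable (fun u => phi k D b (j ^~ u) (e ^~ u)).
Proof.
move=> bD dU U j e mj me; apply: bounded_measurableB.
  apply: (bounded_measurable_ground_state bc
    (K := fun b u => j b u + t * e b u) (fun s => edge_spin R bc s (val b))).
  by move=> b'; apply: measurable_funD => //; apply: measurable_funM.
apply: bounded_measurableM; first exact: bounded_measurable_cst.
have [mg _] : bounded_measurable (fun u => (good D (j ^~ u))%:R : R).
  apply: bounded_measurable_bool.
  rewrite (_ : [set u | _]%classic = [set u | gapped D r (j ^~ u)]%classic `&`
    [set u | within D M (j ^~ u)]%classic)%classic.
    by apply: measurableI; [exact: measurable_gapped | exact: measurable_within].
  by apply/seteqP; split => u /= /andP.
split; first exact: measurable_funM.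
exists M => u; rewrite /good; case: (boolP (within D M (j ^~ u))) => [/withinP h|_].
  by case: gapped; rewrite ?mulr1 ?mulr0 ?normr0 ?(ltW M0)//; exact: h.
by rewrite andbF mulr0 normr0 ltW.
Qed.

Let int_phi_ge0 (k : R) (D : {set closed_edges L}) (b : closed_edges L) :
  b \in D ->
  0 <= \int[P]_w (phi k D b (J ^~ w) (eps ^~ w) * phi k D b (J ^~ w) (eps' ^~ w)).
Proof.
move=> bD; apply: (conditionally_iid_product_ge0 DJ (phi := phi k D b)).
by apply: (bphi k bD (j := fun b (x : family R _) => x (inl b))
  (e := fun b (x : family R _) => x (inr b))) => b'; exact: measurable_coordinate.
Qed.

(** The case [f_b = 0], that is, [k = 0]. *)
Lemma edge_product_ge0 b : 0 <= \int[P]_w (X b w * X' b w).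
Proof.
have := int_phi_ge0 0 (set11 b); congr (0 <= _).
by apply: eq_Rintegral => w _; rewrite /phi !mul0r !subr0.
Qed.

Lemma star_overlap_ge (u : L) : (0 < d)%N -> (0 < N)%N -> (#|star u| <= N)%N ->
  r ^+ 2 / (4 * N%:R * M ^+ 2) <= \sum_(b in star u) \int[P]_w (X b w * X' b w).
Proof.
move=> d0 N0 DN; set D := star u.
have N0' : 0 < N%:R :> R by rewrite ltr0n.
have rNM0 : 0 <= r + N%:R * M by rewrite addr_ge0 ?mulr_ge0 ?ltW.
(* After the failures are paid for, [k r - k^2 N M^2] is left; this [k] maximizes it. *)
have [k kE k0] : exists2 k, k = r / (2 * N%:R * M ^+ 2) & 0 < k.
  by eexists; [by []|rewrite divr_gt0// !mulr_gt0// exprn_gt0].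
rewrite -Rintegral_sum => [|b _]; last exact: bounded_measurableM.
have bS b : b \in D -> bounded_measurable (fun w =>
    phi k D b (J ^~ w) (eps ^~ w) * phi k D b (J ^~ w) (eps' ^~ w)).
  by move=> bD; apply: bounded_measurableM; exact: (bphi k bD).
apply: (le_trans _ (Rintegral_ge_affine
  (S := fun w => \sum_(b in D)
    phi k D b (J ^~ w) (eps ^~ w) * phi k D b (J ^~ w) (eps' ^~ w))
  (A1 := fun w => (~~ gapped D r (J ^~ w))%:R)
  (A2 := fun w => (~~ within D M (J ^~ w))%:R)
  (B1 := fun w => (~~ within D K0 (eps ^~ w))%:R)
  (B2 := fun w => (~~ within D K0 (eps' ^~ w))%:R)
  (c := k * (2 * r) - k ^+ 2 * (N%:R * M ^+ 2))
  (a := k * (2 * r)) (b := k * (r + N%:R * M)) _ _ _ _ _ _ _)).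
- rewrite Rintegral_sum//.
  set S := \sum_(b in D) _.
  have S0 : 0 <= S by rewrite sumr_ge0// => b; exact: int_phi_ge0.
  have := not_gapped_small DN; have := not_withinJ_small DN.
  have [] := not_within_small DN; rewrite -/D.
  set a1 := \int[P]_w _; set a2 := \int[P]_w _; set a3 := \int[P]_w _.
  set a4 := \int[P]_w _ => h1 h2 h3 h4.
  (* From the gain [2 k r], failures of [J] take [3 k r / 4], those of the perturbations [k r / 4]
     and the quadratic term [k r / 2]; what remains is [k r / 2], the claimed bound. *)
  have e1 : k * (2 * r) * (a4 + a3) <= k * (2 * r) * (3 / 8).
    by rewrite ler_pM2l ?mulr_gt0//; lra.
  have e2 : k * (r + N%:R * M) * (a1 + a2) <= k * (r / 4).
    rewrite -mulrA ler_pM2l//.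
    apply: (@le_trans _ _ ((r + N%:R * M) * (2 * (N%:R * eK)))); last first.
      rewrite (_ : _ * _ = 2 * (N%:R * eK * (r + N%:R * M))); last by ring.
      by move: eK_small'; lra.
    by rewrite ler_wpM2l//; lra.
  have e3 : r ^+ 2 / (4 * N%:R * M ^+ 2) = k * r / 2.
    by rewrite kE; field; rewrite !gt_eqF.
  have e4 : k ^+ 2 * (N%:R * M ^+ 2) = k * r / 2.
    by rewrite kE; field; rewrite !gt_eqF.
  rewrite e3 e4; nra.
- by apply: bounded_measurable_sum => b _; exact: bounded_measurableM.
- exact: bounded_measurable_sum.
- by apply: bnot; apply: (measurable_gapped D r (X := fun b => J b)).
- by apply: bnot; apply: (measurable_within D M (X := fun b => J b)).
- by apply: bnot; apply: (measurable_within D K0 (X := fun b => eps b)).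
- by apply: bnot; apply: (measurable_within D K0 (X := fun b => eps' b)).
move=> w; rewrite /=.
pose G : R := (good D (J ^~ w))%:R.
have GG : G * G = G by rewrite /G; case: good; rewrite ?mulr1 ?mulr0.
have G0 : 0 <= G by rewrite /G ler0n.
have expand b : X b w * X' b w =
    phi k D b (J ^~ w) (eps ^~ w) * phi k D b (J ^~ w) (eps' ^~ w) +
    k * (G * (J b w * X b w) + G * (J b w * X' b w)) - k ^+ 2 * (G * J b w ^+ 2).
  rewrite /phi -/(X b w) -/(X' b w) -/G.
  rewrite -[in k ^+ 2 * (G * _)]GG.
  by rewrite /X /X' /perturb; ring.
rewrite (eq_bigr _ (fun b _ => expand b)) sumrB big_split /= -!addrA lerD2l.
rewrite -!mulr_sumr big_split /= -!mulr_sumr.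
have G1 : 1 - (~~ gapped D r (J ^~ w))%:R - (~~ within D M (J ^~ w))%:R <= G.
  by rewrite /G /good; do 2 case: (_ D _ _) => /=; lra.
have square : G * \sum_(b in D) J b w ^+ 2 <= N%:R * M ^+ 2.
  rewrite /G /good; case: (boolP (within D M (J ^~ w))) => [/withinP hM|_].
    apply: (@le_trans _ _ (\sum_(b in D) J b w ^+ 2)).
      rewrite ler_piMl// ?sumr_ge0// => [b _|]; first exact: sqr_ge0.
      by rewrite lern1 leq_b1.
    apply: (@le_trans _ _ (#|D|%:R * M ^+ 2)); last first.
      by rewrite ler_wpM2r ?sqr_ge0// ler_nat.
    rewrite mulr_natl -sumr_const ler_sum// => b bD.
    by rewrite -real_normK ?num_real// lerXn2r ?nnegrE ?normr_ge0 ?(ltW M0)// hM.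
  by rewrite andbF mul0r mulr_ge0 ?sqr_ge0.
have D0 : D != finset.set0 by exact: star_gt0.
(* For good [J] the local field is at least [r] when the perturbation is bounded by [K0], and at
   least [- N M] otherwise, which accounts for the loss [r + N M]. Off the good event the left side
   is at most 0. *)
have field (e : closed_edges L -> {RV P >-> R}) :
    r * G - (r + N%:R * M) * (~~ within D K0 (e ^~ w))%:R <=
    G * \sum_(b in D) J b w *
      edge_spin R bc (ground_state bc (perturb J e t w)) (val b).
  rewrite /G /good; case: (boolP (gapped _ _ _)) => [gJ|_] /=; last first.
    by rewrite mulr0 mul0r sub0r oppr_le0 mulr_ge0.
  case: (boolP (within D M _)) => [/withinP hM|_]; last first.
    by rewrite mulr0 mul0r sub0r oppr_le0 mulr_ge0.
  rewrite mulr1 mul1r; case: (boolP (within D K0 _)) => [hK|_].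
    rewrite mulr0 subr0; apply: (gapped_local_field bc D0 gJ hK t0).
    by apply: le_lt_trans t_small; rewrite ler_wpM2l// ler_wpM2r ?ler_nat// ltW.
  rewrite mulr1 opprD addrA subrr add0r lerNl.
  apply: le_trans (ler_norm _) _; rewrite normrN.
  apply: le_trans (ler_norm_sum _ _ _) _.
  apply: (@le_trans _ _ (#|D|%:R * M)); last by rewrite ler_wpM2r ?ler_nat ?ltW.
  rewrite mulr_natl -sumr_const ler_sum// => b bD.
  by rewrite normrM normr_edge_spin mulr1 hM.
set A := (~~ gapped _ _ _)%:R in G1 *; set B := (~~ within D M _)%:R in G1 *.
set C := (~~ within D K0 (eps ^~ w))%:R; set C' := (~~ within D K0 (eps' ^~ w))%:R.
set S := G * \sum_(b in D) J b w * X b w; set S' := G * \sum_(b in D) J b w * X' b w.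
have f1 : r * G - (r + N%:R * M) * C <= S := field eps.
have f2 : r * G - (r + N%:R * M) * C' <= S' := field eps'.
have m1 : k * (2 * r * (1 - A - B)) <= k * (2 * r * G).
  by rewrite ler_pM2l// ler_pM2l// mulr_gt0.
have m2 : k * (2 * r * G - (r + N%:R * M) * (C + C')) <= k * (S + S').
  by rewrite ler_pM2l//; lra.
have m3 := ler_wpM2l (sqr_ge0 k) square.
lra.
Qed.

Lemma expectation_overlap :
  \int[P]_w overlap R (ground_state bc (perturb J eps t w))
                     (ground_state bc (perturb J eps' t w)) =
  (#|` edges L|%:R)^-1 *
  \sum_(b : closed_edges L | val b \in edges L) \int[P]_w (X b w * X' b w).
Proof.
under eq_Rintegral do rewrite (overlapE R bc) sum_edges.
have bXX b : bounded_measurable (fun w => X b w * X' b w) by exact: bounded_measurableM.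
rewrite RintegralZl//; last first.
  apply: bounded_measurable_integrable; apply: bounded_measurable_sum => b _.
  exact: bXX.
by rewrite Rintegral_sum// => b _; exact: bXX.
Qed.

Lemma bounded_measurable_overlap :
  bounded_measurable (fun w => overlap R (ground_state bc (perturb J eps t w))
                                         (ground_state bc (perturb J eps' t w))).
Proof.
rewrite (_ : (fun w => _) = fun w => (#|` edges L|%:R)^-1 *
    \sum_(b : closed_edges L | val b \in edges L) X b w * X' b w).
  apply: bounded_measurableM; first exact: bounded_measurable_cst.
  by apply: bounded_measurable_sum => b _; exact: bounded_measurableM.
by apply/funext => w; rewrite (overlapE R bc) sum_edges.
Qed.

(** By double counting the right side is a sum over vertices. Those in [I] have their whole star
    inside [L] and contribute the star bound; the others contribute at least 0, edge by edge. *)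
Lemma overlap_ge_stars (I : pred L) : (0 < d)%N -> (2 * d <= N)%N ->
  (0 < #|` edges L|)%N ->
  (forall (u : L) (b : closed_edges L), I u -> b \in star u -> val b \in edges L) ->
  \sum_(u : L) (if I u then r ^+ 2 / (4 * N%:R * M ^+ 2) else 0) <=
  2 * #|` edges L|%:R *
  \int[P]_w overlap R (ground_state bc (perturb J eps t w))
                     (ground_state bc (perturb J eps' t w)).
Proof.
move=> d0 dN e0 intI.
rewrite expectation_overlap [leRHS]mulrA mulfK ?pnatr_eq0 -?lt0n//.
rewrite double_count ler_sum// => u _; case: ifP => Iu; last first.
  by apply: sumr_ge0 => b _; exact: edge_product_ge0.
have N0 : (0 < N)%N by apply: leq_trans dN; rewrite muln_gt0.
apply: (le_trans (star_overlap_ge d0 N0 (leq_trans (card_star_le u) dN))).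
rewrite le_eqVlt; apply/orP; left; apply/eqP; apply: eq_bigl => b.
by case: (boolP (b \in star u)) => //= bu; rewrite (intI u b Iu bu).
Qed.

(** When no failure occurs, both ground states have the edge products of the unperturbed one and the
    overlap is 1; otherwise it is at least -1. Three failures of probability at most [1 / 8], each
    costing 2, leave [1 / 4]. *)
Lemma overlap_ge_stable : (#|{: closed_edges L}| <= N)%N ->
  (0 < #|` edges L|)%N ->
  1 / 4 <= \int[P]_w overlap R (ground_state bc (perturb J eps t w))
                              (ground_state bc (perturb J eps' t w)).
Proof.
move=> LN e0; pose D : {set closed_edges L} := finset.setT.
have DN : (#|D| <= N)%N by rewrite cardsT.
have [W W'] := not_within_small DN; have A := not_gapped_small DN.
apply: (le_trans _ (Rintegral_ge_affine
  (S := fun _ => 0)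
  (A1 := fun w => (~~ gapped D r (J ^~ w))%:R) (A2 := fun _ => 0)
  (B1 := fun w => (~~ within D K0 (eps ^~ w))%:R)
  (B2 := fun w => (~~ within D K0 (eps' ^~ w))%:R)
  (c := 1) (a := 2) (b := 2) _ _ _ _ _ _ _)).
- by rewrite !Rintegral_cstT; move: eK_small; lra.
- exact: bounded_measurable_overlap.
- exact: bounded_measurable_cst.
- by apply: bnot; apply: (measurable_gapped D r (X := fun b => J b)).
- exact: bounded_measurable_cst.
- by apply: bnot; apply: (measurable_within D K0 (X := fun b => eps b)).
- by apply: bnot; apply: (measurable_within D K0 (X := fun b => eps' b)).
move=> w; set s := ground_state _ (perturb _ eps _ _).
set s' := ground_state _ (perturb _ eps' _ _).
have e0' : 0 < #|` edges L|%:R :> R by rewrite ltr0n.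
have tD : t * (#|{: closed_edges L}|%:R * K0) < r.
  by apply: le_lt_trans t_small; rewrite ler_wpM2l// ler_wpM2r ?ler_nat// ltW.
case: (boolP (gapped D r _)) => [gJ|_];
  first case: (boolP (within D K0 (eps ^~ w))) => [h|_];
  first case: (boolP (within D K0 (eps' ^~ w))) => [h'|_].
  rewrite (overlapE R bc) sum_edges (eq_bigr (fun=> 1)) => [|b _]; last first.
    rewrite (gapped_stable bc gJ h t0 (ltW K00) tD).
    rewrite (gapped_stable bc gJ h' t0 (ltW K00) tD).
    by have [->|->] := edge_spin_sign R bc (ground_state bc (J ^~ w)) (val b); lra.
  rewrite -(sum_edges _ (fun=> 1)) big_const_seq count_predT iter_addr_0.
  by rewrite mulVf ?gt_eqF//=; lra.
all: have := normr_overlap_le1 R bc s s'; rewrite ler_norml => /andP[Q _].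
all: have hC := ler0n R (~~ within D K0 (eps ^~ w)).
all: have hC' := ler0n R (~~ within D K0 (eps' ^~ w)).
all: by rewrite /=; lra.
Qed.

End Estimates.

(** * Choice of the constants and conclusion *)

Lemma expn_add2_le (m d : nat) : (0 < d)%N -> (m.+3 ^ d <= 3 ^ d * m.+1 ^ d)%N.
Proof. by move=> d0; rewrite -expnMn leq_exp2r//; lia. Qed.

Theorem theorem1p1 (R : realType) (d : nat) (hd : (0 < d)%N)
    (muJ mueps : probability R R)
    (hJ : atomless muJ) (heps : atomless mueps) (heps0 : centered mueps) :
  exists2 c : R, 0 < c &
  exists2 t0 : R -> R, (forall delta : R, 0 < delta -> 0 < t0 delta) &
  forall (a : vertex d) (n : nat) (bc : vertex d -> bool), (2 <= n)%N ->
  forall (dT : measure_display) (T : measurableType dT) (P : probability T R)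
    (J eps eps' : closed_edges (box a n) -> {RV P >-> R}),
  disorder muJ mueps J eps eps' ->
  exists A : set T,
    [/\ measurable A,
        (c%:E <= P A)%E &
        forall delta t : R, 0 < delta -> 0 <= t < t0 delta ->
          ((1 - delta)%:E * P A <
           'E_P[fun w => overlap R
                  (ground_state bc (perturb J eps t w))
                  (ground_state bc (perturb J eps' t w))])%E].
Proof.
(* [2 * d] bounds a star, and [4 ^ d * 4 ^ d] bounds the closed edges of a box of side 2. *)
pose N := maxn (2 * d) (4 ^ d * 4 ^ d).
have dN : (2 * d <= N)%N by exact: leq_maxl.
have N0 : 0 < N%:R :> R by rewrite ltr0n (leq_trans _ dN)// muln_gt0.
have N0' : 0 < 4 ^+ N :> R by rewrite exprn_gt0.
have [r r0 hr] := atomless_concentration hJ (e := 1 / 8 / 4 ^+ N)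
  ltac:(by rewrite !divr_gt0).
have [M M0 hM] := tail_small muJ (e := 1 / 4 / N%:R) ltac:(by rewrite !divr_gt0).
pose rNM := r + N%:R * M; have rNM0 : 0 < rNM by rewrite addr_gt0 ?mulr_gt0.
pose eK := Num.min (1 / 8) (r / 8 / rNM) / N%:R.
have eK0 : 0 < eK by rewrite divr_gt0// lt_min !divr_gt0.
have NeK : N%:R * eK = Num.min (1 / 8) (r / 8 / rNM).
  by rewrite mulrC divfK// gt_eqF.
have [K0 K00 hK] := tail_small mueps eK0.
pose c1 := r ^+ 2 / (4 * N%:R * M ^+ 2).
have c10 : 0 < c1 by rewrite divr_gt0 ?mulr_gt0 ?exprn_gt0.
have d0 : 0 < (2 * d * 3 ^ d)%:R :> R by rewrite ltr0n !muln_gt0 hd expn_gt0.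
(* [1 / 4] is for side 2. For side [m.+3], each of the [m.+1 ^ d] interior vertices gives [c1],
   while twice the number of edges is at most [2 * d * m.+3 ^ d]. *)
pose c := Num.min (1 / 4) (c1 / (2 * d * 3 ^ d)%:R).
have c0 : 0 < c by rewrite lt_min (divr_gt0 c10 d0) divr_gt0.
have [B mB /andP[B0 Bc]] := atomless_small_set hJ c0.
have BE := fineK (fin_num_measure muJ _ mB).
exists (fine (muJ B)); first by rewrite -lte_fin BE.
(* One threshold works for every [delta], since the probability of the event is at most [c], and [c]
   bounds the expected overlap from below. *)
exists (fun=> r / (N%:R * K0)) => [_ _|]; first by rewrite divr_gt0 ?mulr_gt0.
move=> a n bc n2 dT T P J eps eps' DJ.
have e0 := edges_box_neq0 a hd n2.
have Qc t : 0 <= t -> t < r / (N%:R * K0) ->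
    c <= \int[P]_w overlap R (ground_state bc (perturb J eps t w))
                            (ground_state bc (perturb J eps' t w)).
  move=> t0 tK.
  have tNK : t * (N%:R * K0) < r by rewrite -ltr_pdivlMr ?mulr_gt0.
  have s1 : 4 ^+ N * (1 / 8 / 4 ^+ N) <= 1 / 8 :> R.
    by rewrite mulrC divfK ?gt_eqF.
  have s2 : N%:R * (1 / 4 / N%:R) <= 1 / 4 :> R by rewrite mulrC divfK ?gt_eqF.
  have s3 : N%:R * eK <= 1 / 8 by rewrite NeK ge_min lexx.
  have s4 : N%:R * eK * (r + N%:R * M) <= r / 8.
    by rewrite -/rNM NeK -ler_pdivlMr// ge_min lexx orbT.
  case: n n2 J eps eps' DJ e0 => [|[|[|m]]]// _ J eps eps' DJ e0.
    apply: (@le_trans _ _ (1 / 4)); first by rewrite ge_min lexx.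
    apply: (overlap_ge_stable bc DJ K00 t0 hr s1 hK s3 tNK) => //.
    rewrite -cardfE; apply: leq_trans (card_closed_edges_box a 2) _.
    exact: leq_maxr.
  have := overlap_ge_stars bc DJ r0 M0 K00 t0 hr s1 hM s2 hK s4 tNK
    (I := fun u => val u \in box (a + ones d 1) m.+1) hd dN e0
    (fun u b => @star_interior d a m.+1 u b).
  rewrite sum_interior -/c1; set Q := \int[P]_w _ => hQ.
  apply: (@le_trans _ _ (c1 / (2 * d * 3 ^ d)%:R)); first by rewrite ge_min lexx orbT.
  (* Positivity of [Q] allows its factor, twice the number of edges, to be replaced by an upper
     bound. *)
  have Q0 : 0 < Q.
    rewrite -(pmulr_rgt0 _ (x := 2 * #|` edges (box a m.+3)|%:R)).
      by apply: lt_le_trans hQ; rewrite pmulrn_lgt0// expn_gt0.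
    by rewrite mulr_gt0// ltr0n.
  have md0 : 0 < (m.+1 ^ d)%:R :> R by rewrite ltr0n expn_gt0.
  rewrite ler_pdivrMr// -(ler_pM2r md0) mulr_natr (le_trans hQ)//.
  rewrite -[leRHS]mulrA [leRHS]mulrC ler_pM2r//.
  apply: (le_trans (card_edges_le_degree R _)); rewrite card_box -!natrM ler_nat.
  by rewrite -[leqRHS]mulnA leq_mul2l expn_add2_le ?orbT.
have [b bE] : exists b, b \in closed_edges (box a n).
  have /fset0Pn[b bE] : edges (box a n) != fset0 by rewrite -cardfs_gt0.
  by exists b; apply: (fsubsetP (edges_sub_closed _)).
(* The event is that the coupling of one arbitrary edge falls in [B]; its probability [muJ B] is the
   same for every box. *)
pose b0 : closed_edges (box a n) := FSetSub bE.
have [iJ _ _] := disorder_iid DJ.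
have PA : P (J b0 @^-1` B)%classic = muJ B by exact: (iid_marginal iJ).
exists (J b0 @^-1` B)%classic; rewrite PA; split.
- exact: measurable_funPTI.
- by rewrite BE.
move=> delta t delta0 /andP[t0 tK].
rewrite (expectation_Rintegral P (bounded_measurable_overlap bc J eps eps' t)).
rewrite -BE -EFinM lte_fin.
have fB0 : 0 < fine (muJ B) by rewrite -lte_fin BE.
have fBc : fine (muJ B) <= c by rewrite -lee_fin BE.
apply: lt_le_trans (Qc t t0 tK).
by apply: lt_le_trans fBc; rewrite gtr_pMl// gtrBl.
Qed.
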